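(* There exists a value $R_1$ such that the geodesic disk $D_R$ of radius $R$ on the cylinder $\mathbb{S}^1\times\mathbb{R}$ does not satisfy Pólya's conjecture for any $R>R_1$. The constant $R_1$ may be taken to be $3.76085$.
   Context: $\mathbb{S}^1$ is the unit circle (of length $2\pi$), and $\mathbb{S}^1\times\mathbb{R}$ carries the flat product metric. The geodesic disk $D_R$ is the set of points of $\mathbb{S}^1\times\mathbb{R}$ at geodesic distance less than $R$ from a fixed point; using coordinates $(x,y)$ with $x\in[-\pi,\pi]$ (and $x=\pm\pi$ identified) and the centre at $(0,0)$, one has $D_R=\{(x,y): x^2+y^2<R^2\}$. A bounded domain $\Omega\subset\mathbb{S}^1\times\mathbb{R}$ satisfies Pólya's conjecture if its Dirichlet Laplacian eigenvalues $\lambda_1(\Omega)\le\lambda_2(\Omega)\le\cdots$ (counted with multiplicity) satisfy $\lambda_k(\Omega)\ge4\pi k/|\Omega|$ for all $k\ge1$, where $|\Omega|$ is the area of $\Omega$. *)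

(* Defs.v *)
From HB Require Import structures.
From mathcomp Require Import all_boot all_order all_algebra.
From mathcomp Require Import all_classical all_reals all_analysis.

Set Implicit Arguments.
Unset Strict Implicit.
Unset Printing Implicit Defensive.

Import Order.TTheory GRing.Theory Num.Theory numFieldNormedType.Exports.
Local Open Scope classical_set_scope.
Local Open Scope ring_scope.

(* The cylinder S^1 x R, with S^1 = R / 2 pi Z, is handled through its
   universal cover R x R: a subset of the cylinder is represented by its
   preimage in R * R, a 2 pi-periodic set in the first coordinate. *)

(* Distance on the cylinder between the classes of p and q: the least
   Euclidean distance between lifts of the two points. *)
Definition cyl_dist (R : realType) (p q : R * R) : R :=
  inf [set Num.sqrt ((p.1 - q.1 + n%:~R * (2 * pi)) ^+ 2 + (p.2 - q.2) ^+ 2)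
      | n in [set: int]].

Definition geodesic_disk (R : realType) (c : R * R) (r : R) : set (R * R) :=
  [set p | cyl_dist p c < r].

Definition strip (R : realType) : set (R * R) :=
  [set p | - pi <= p.1 <= pi].

Arguments strip : clear implicits.

(* Integrals over a subset of the cylinder are integrals over the part of its
   lift that lies in [-pi, pi] x R; the doubled edges x = -pi and x = pi are
   negligible. *)
Definition cell (R : realType) (Om : set (R * R)) : set (R * R) :=
  Om `&` strip R.

Definition leb2 (R : realType) :=
  ((@lebesgue_measure R) \x (@lebesgue_measure R))%E.

Arguments leb2 : clear implicits.

Definition area (R : realType) (Om : set (R * R)) : R :=
  fine (leb2 R (cell Om)).

Definition dx (R : realType) (f : R * R -> R) : R * R -> R :=
  fun p => 'D_((1 : R), (0 : R)) f p.

Definition dy (R : realType) (f : R * R -> R) : R * R -> R :=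
  fun p => 'D_((0 : R), (1 : R)) f p.

Fixpoint class_C (R : realType) (k : nat) (f : R * R -> R) : Prop :=
  continuous f /\
  if k is k'.+1 then
    [/\ forall p, derivable f p ((1 : R), (0 : R)),
        forall p, derivable f p ((0 : R), (1 : R)),
        class_C k' (dx f) & class_C k' (dy f)]
  else True.

Definition smooth (R : realType) (f : R * R -> R) : Prop :=
  forall k, class_C k f.

(* C_c^oo(Om). The support of the periodic lift is never compact; what is
   required is that its image in the cylinder be. *)
Definition test_function (R : realType) (Om : set (R * R))
    (phi : R * R -> R) : Prop :=
  let supp := closure [set p | phi p != 0] in
  [/\ smooth phi,
      forall x y, phi (x + 2 * pi, y) = phi (x, y),
      supp `<=` Om
    & compact (supp `&` strip R)].

(* Elements of L^2(Om) are represented by functions of which only the values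
   on cell Om matter. *)
Definition in_L2 (R : realType) (Om : set (R * R)) (f : R * R -> R) : Prop :=
  measurable_fun (cell Om) f /\
  (\int[leb2 R]_(p in cell Om) ((f p) ^+ 2)%:E < +oo)%E.

Definition cvg_L2 (R : realType) (Om : set (R * R))
    (fs : nat -> R * R -> R) (f : R * R -> R) : Prop :=
  (fun n => \int[leb2 R]_(p in cell Om) ((fs n p - f p) ^+ 2)%:E)%E
    @ \oo --> 0%E.

(* u belongs to H^1_0(Om), the closure of C_c^oo(Om) in H^1(Om), and has weak
   gradient (g1, g2). *)
Definition in_H10 (R : realType) (Om : set (R * R))
    (u g1 g2 : R * R -> R) : Prop :=
  [/\ in_L2 Om u, in_L2 Om g1, in_L2 Om g2 &
      exists phi : nat -> R * R -> R,
        [/\ forall n, test_function Om (phi n),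
            cvg_L2 Om phi u,
            cvg_L2 Om (fun n => dx (phi n)) g1
          & cvg_L2 Om (fun n => dy (phi n)) g2]].

(* u belongs to the eigenspace of the Dirichlet Laplacian for lam: u is in
   H^1_0(Om) and - Laplacian u = lam u weakly. The case u = 0 is allowed. *)
Definition dirichlet_eigenspace (R : realType) (Om : set (R * R)) (lam : R)
    (u : R * R -> R) : Prop :=
  exists g1 g2 : R * R -> R,
    in_H10 Om u g1 g2 /\
    forall psi, test_function Om psi ->
      \int[leb2 R]_(p in cell Om) (g1 p * dx psi p + g2 p * dy psi p)
      = lam * \int[leb2 R]_(p in cell Om) (u p * psi p).

Definition L2_independent (R : realType) (Om : set (R * R)) (k : nat)
    (u : 'I_k -> R * R -> R) : Prop :=
  forall c : 'I_k -> R,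
    {ae leb2 R, forall p, cell Om p -> \sum_(i < k) c i * u i p = 0} ->
    forall i, c i = 0.

(* At least k Dirichlet eigenvalues, counted with multiplicity, are <= mu.
   Eigenspaces for different eigenvalues being independent, this is the
   existence of k independent eigenfunctions with eigenvalues <= mu. *)
Definition eigenvalue_count_ge (R : realType) (Om : set (R * R)) (k : nat)
    (mu : R) : Prop :=
  exists (lam : 'I_k -> R) (u : 'I_k -> R * R -> R),
    [/\ forall i, lam i <= mu,
        forall i, dirichlet_eigenspace Om (lam i) (u i)
      & L2_independent Om u].

(* The k-th term (k >= 1) of the nondecreasing list of the Dirichlet
   eigenvalues repeated according to multiplicity; +oo if there are fewer
   than k of them. *)
Definition dirichlet_eigenvalue (R : realType) (Om : set (R * R)) (k : nat)
    : \bar R :=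
  ereal_inf [set mu%:E | mu in [set mu | eigenvalue_count_ge Om k mu]].

Definition satisfies_polya (R : realType) (Om : set (R * R)) : Prop :=
  forall k : nat, (1 <= k)%N ->
    ((4 * pi * k%:R / area Om)%:E <= dirichlet_eigenvalue Om k)%E.

(* In the coordinates x in [-pi, pi], the disk centred at the origin is
   x^2 + y^2 < r^2. *)
Lemma geodesic_diskE (R : realType) (r x y : R) : 0 < r -> - pi <= x <= pi ->
  geodesic_disk (0, 0) r (x, y) <-> x ^+ 2 + y ^+ 2 < r ^+ 2.
Proof.
move=> r0 /andP[xl xr].
rewrite /geodesic_disk /cyl_dist /=; set A := (X in inf X).
have A0 : A (Num.sqrt (x ^+ 2 + y ^+ 2)).
  by exists 0 => //; rewrite mul0r addr0 !subr0.
have minA : lbound A (Num.sqrt (x ^+ 2 + y ^+ 2)).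
  move=> _ [n _ <-]; rewrite !subr0; apply: ler_wsqrtr; rewrite lerD2r.
  have p0 := pi_ge0 R.
  rewrite -[leLHS]real_normK ?num_real// -[leRHS]real_normK ?num_real//.
  rewrite lerXn2r ?nnegrE//.
  have [->|n0] := eqVneq n 0; first by rewrite mul0r addr0.
  have n1 : 1 <= `|n%:~R : R|.
    by rewrite -intr_norm -[1]/(1%:~R) ler_int -gtz0_ge1 normr_gt0.
  have xpi : `|x| <= pi by rewrite ler_norml xl xr.
  have h : 2 * pi <= `|n%:~R * (2 * pi) : R|.
    by rewrite normrM (ger0_norm (mulr_ge0 _ p0))// ler_peMl ?mulr_ge0.
  have := ler_normB (x + n%:~R * (2 * pi)) x.
  rewrite addrAC subrr add0r => t.
  have := le_trans h t; rewrite -lerBlDr; apply: le_trans.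
  by rewrite lerBrDr (le_trans (lerD xpi xpi))// mulr_natl mulr2n.
have -> : inf A = Num.sqrt (x ^+ 2 + y ^+ 2).
  apply/eqP; rewrite eq_le; apply/andP; split.
    by apply: ge_inf => //; exists (Num.sqrt (x ^+ 2 + y ^+ 2)).
  by apply: lb_le_inf => //; exists (Num.sqrt (x ^+ 2 + y ^+ 2)).
have rE : Num.sqrt (r ^+ 2) = r by rewrite sqrtr_sqr gtr0_norm.
by rewrite -[X in _ < X]rE ltr_sqrt ?exprn_gt0.
Qed.

(* Main.v *)
(** The conjectured bound already fails for the first eigenvalue. The trial
function is c(y / l(x)), where l(x) = sqrt(r^2 - x^2) is half the height of the
disk above x and c(t) = s (3 + 2 s) with s = 1 - t^2, a profile whose Rayleigh
quotient on [-1, 1] is close to the least one, pi^2 / 4. The squared L^2 norm of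
the trial function is a multiple of the area of the disk, so lambda_1 |D_R| < 4 pi
reduces to an upper bound on the energy alone. When r exceeds pi the disk wraps
around the cylinder and the energy is at most an integral over [-pi, pi] of
expressions in l that decrease with r and have explicit primitives (arc sine and
tangent). Genuine test functions are obtained by smoothing |x|, of which l is
a function, and by cutting off c with a factor exp(- eps / s).

The eigenvalue of the formal statement is an infimum over eigenvalues having an
eigenfunction, so the first eigenfunction must be constructed: Poincare's
inequality on small cells makes the energy coercive up to finitely many linear
functionals, hence a minimizing sequence along which these functionals converge
is Cauchy by the parallelogram law, and L^2 is complete. *)
Require Import Defs.
From HB Require Import structures.
From mathcomp Require Import all_boot all_order all_algebra.
From mathcomp Require Import all_classical all_reals all_analysis.
From mathcomp Require Import measurable_realfun ring lra.

Set Implicit Arguments.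
Unset Strict Implicit.
Unset Printing Implicit Defensive.

Import Order.TTheory GRing.Theory Num.Theory numFieldNormedType.Exports.
Local Open Scope classical_set_scope.
Local Open Scope ring_scope.

(** With l' = - x / l, integrating in y gives the energy density (6232/105) / l + (1288/45) x^2 /
    l^3, and x^2 = r^2 - l^2 leaves only multiples of 1 / l and 1 / l^3. For fixed x the density
    decreases with r, so one numerical inequality at a fixed [rho1] slightly below the threshold
    settles every larger radius. For the exact integrals that inequality has a margin of about one
    percent, which pays for the smoothing, the cut-off and rough bounds on pi. The smoothing is
    forced by the wrapping: the periodic extension of l has a corner at x = pi, where the disk meets
    itself, whereas test functions are smooth. Replacing |x| by acos (cos kap * cos x) moves it by
    at most kap, hence its square by at most 2 pi kap + kap^2 <= 7 kap. This is paid twice: r^2 - 7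
    kap keeps the support in the open disk, and r^2 - 14 kap appears when returning to x itself. *)

Definition lin (R : realType) (T : Type) (s t : R) (u v : T -> R) : T -> R :=
  fun x => s * u x + t * v x.

(** * Square-integrable functions on a set, and their completeness *)

Section L2.
Context d (T : measurableType d) (R : realType).
Variables (mu : {measure set T -> \bar R}) (D : set T).
Hypothesis mD : measurable D.
Implicit Types f g h : T -> R.

(** Functions are not identified almost everywhere, so that this unfolds to [in_L2]; [dot] is then
    only positive semidefinite. *)
Definition L2 f := measurable_fun D f /\
  (\int[mu]_(x in D) ((f x) ^+ 2)%:E < +oo)%E.

Definition dot f g : R := \int[mu]_(x in D) (f x * g x).

Lemma L2P f : L2 f <-> measurable_fun D f /\
  mu.-integrable D (EFin \o (fun x => f x ^+ 2)).
Proof.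
split=> -[mf f2]; split=> //.
  apply/integrableP; split; first by apply/measurable_EFinP; exact: measurable_funX.
  by under eq_integral => x _ do rewrite /= ger0_norm ?sqr_ge0//.
move/integrableP : f2 => [_].
by under eq_integral => x _ do rewrite /= ger0_norm ?sqr_ge0//.
Qed.

Lemma L2_mul_integrable f g : L2 f -> L2 g ->
  mu.-integrable D (EFin \o (fun x => f x * g x)).
Proof.
move=> /L2P[mf f2] /L2P[mg g2].
apply: (le_integrable mD _ _ (integrableD mD f2 g2)).
  by apply/measurable_EFinP; exact: measurable_funM.
move=> x Dx /=; rewrite lee_fin ler_norml.
rewrite ger0_norm ?addr_ge0 ?sqr_ge0//.
by apply/andP; split; nra.
Qed.

Lemma L2_lin f g (a b : R) : L2 f -> L2 g -> L2 (lin a b f g).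
Proof.
move=> /L2P[mf f2] /L2P[mg g2]; apply/L2P.
have mfg : measurable_fun D (fun x => a * f x + b * g x).
  by apply: measurable_funD; exact: measurable_funM.
split=> //.
have := integrableD mD (integrableZl mD (2 * a ^+ 2) f2)
                       (integrableZl mD (2 * b ^+ 2) g2).
apply: (le_integrable mD).
  by apply/measurable_EFinP; exact: measurable_funX.
move=> x Dx /=; rewrite lee_fin /lin.
have s0 (c t : R) : 0 <= 2 * c ^+ 2 * t ^+ 2.
  exact: (mulr_ge0 (mulr_ge0 (ler0n _ 2) (sqr_ge0 _)) (sqr_ge0 _)).
have a0 := s0 a (f x); have b0 := s0 b (g x).
rewrite (ger0_norm (sqr_ge0 _)) ger0_norm ?addr_ge0//.
have := sqr_ge0 (a * f x - b * g x); nra.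
Qed.

Lemma dotC f g : dot f g = dot g f.
Proof. by apply: eq_Rintegral => x _; rewrite mulrC. Qed.

Lemma dotDl f g h (a b : R) : L2 f -> L2 g -> L2 h ->
  dot (lin a b f g) h = a * dot f h + b * dot g h.
Proof.
move=> Lf Lg Lh; rewrite /dot /lin.
have ifh := L2_mul_integrable Lf Lh; have igh := L2_mul_integrable Lg Lh.
rewrite -!RintegralZl// -RintegralD//; last 2 first.
- exact: (integrableZl mD a ifh).
- exact: (integrableZl mD b igh).
by apply: eq_Rintegral => x _; rewrite mulrDl !mulrA.
Qed.

Lemma dot_ge0 f : 0 <= dot f f.
Proof. by apply: Rintegral_ge0 => x _; rewrite -expr2 sqr_ge0. Qed.

Lemma dotE f : L2 f -> (\int[mu]_(x in D) ((f x) ^+ 2)%:E)%E = (dot f f)%:E.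
Proof.
move=> [mf f2]; rewrite /dot /Rintegral.
under [in RHS]eq_integral do rewrite -expr2.
rewrite fineK// ge0_fin_numE//.
by apply: integral_ge0 => x _; rewrite lee_fin sqr_ge0.
Qed.

End L2.

(** For c > 0 the quadratic is evaluated at its minimum t = - b / c. For c = 0 a nonzero b is
    excluded by the t that makes a + 2 t b equal to - 1. *)
Lemma discriminant_le (R : realType) (a b c : R) : 0 <= a -> 0 <= c ->
  (forall t : R, 0 <= a + 2 * t * b + t ^+ 2 * c) -> b ^+ 2 <= a * c.
Proof.
move=> a0; rewrite le_eqVlt => /predU1P[<- h|c0 h].
  have [->|b0] := eqVneq b 0; first by rewrite expr0n mulr0.
  have := h (- (a + 1) / (2 * b)).
  rewrite (_ : 2 * _ * b = - (a + 1)); last by field; rewrite b0.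
  lra.
have := h (- b / c).
rewrite (_ : _ + _ = (a * c - b ^+ 2) / c); last by field; rewrite gt_eqF.
by rewrite pmulr_lge0 ?invr_gt0// subr_ge0.
Qed.

Section L2_complete.
Context d (T : measurableType d) (R : realType).
Variables (mu : {measure set T -> \bar R}) (D : set T).
Hypothesis mD : measurable D.
Implicit Types f g h : T -> R.
Local Notation L2 := (L2 mu D).
Local Notation dot := (dot mu D).

Lemma dot_sqr_lin f g (t : R) : L2 f -> L2 g ->
  dot (lin 1 t f g) (lin 1 t f g) =
  dot f f + 2 * t * dot f g + t ^+ 2 * dot g g.
Proof.
move=> Lf Lg; have Lfg := L2_lin mD 1 t Lf Lg.
rewrite dotDl// [dot f (fun _ => _)]dotC [dot g (fun _ => _)]dotC !dotDl//.
by rewrite [dot g f]dotC; ring.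
Qed.

Lemma cauchy_schwarz f g : L2 f -> L2 g -> dot f g ^+ 2 <= dot f f * dot g g.
Proof.
move=> Lf Lg; apply: discriminant_le; rewrite ?dot_ge0// => t.
by rewrite -dot_sqr_lin// dot_ge0.
Qed.

Local Notation sub := (lin 1 (-1)).

(* Completeness is stated for sequences that converge fast, so that they
   converge almost everywhere without extraction. *)
Lemma L2_complete (f : nat -> T -> R) : (forall n, L2 (f n)) ->
  (forall n m, (n <= m)%N ->
    dot (sub (f n) (f m)) (sub (f n) (f m)) <= 8%:R ^- n) ->
  exists2 g, L2 g & forall n, dot (sub (f n) g) (sub (f n) g) <= 8%:R ^- n.
Proof.
move=> Lf Cf.
(* The weight 4 ^ n still leaves integrals at most 2 ^- n, so the sum [S] is integrable. Where [S]
   is finite, the increments of f are at most (S + 1) / 2 ^ n. *)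
pose h n x : \bar R := (4%:R ^+ n * (sub (f n) (f n.+1) x) ^+ 2)%:E.
have Lsub n m : L2 (sub (f n) (f m)) by exact: L2_lin.
have mh n : measurable_fun D (h n).
  apply/measurable_EFinP; apply: measurable_funM => //.
  by apply: measurable_funX; exact: (Lsub _ _).1.
have h0 n x : D x -> (0 <= h n x)%E.
  by move=> _; rewrite lee_fin mulr_ge0 ?sqr_ge0// exprn_ge0.
pose S x := (\sum_(0 <= n <oo) h n x)%E.
have mS : measurable_fun D S.
  have : measurable_fun D (fun x => \sum_(0 <= i <oo | i \in xpredT) h i x)%E.
    by apply: ge0_emeasurable_sum => [k x Dx _|k _]; [exact: h0|exact: mh].
  exact.
have S0 x : D x -> (0 <= S x)%E.
  by move=> Dx; apply: nneseries_ge0 => n _ _; exact: h0.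
have inth n : (\int[mu]_(x in D) h n x <= (2 / (2 ^ (n + 1))%:R)%:E)%E.
  under eq_integral do rewrite /h EFinM.
  rewrite ge0_integralZl_EFin//; last 2 first.
  - by move=> x _; rewrite lee_fin sqr_ge0.
  - by apply/measurable_EFinP/measurable_funX; exact: (Lsub _ _).1.
  rewrite dotE// -EFinM lee_fin.
  apply: (@le_trans _ _ (4%:R ^+ n * 8%:R ^- n)).
    by rewrite ler_wpM2l ?exprn_ge0// Cf.
  rewrite addn1 expnS natrM natrX (_ : 8%:R = 4%:R * 2%:R :> R) -?natrM//.
  rewrite natrM exprMn invfM mulrA mulfV ?mul1r ?expf_neq0//.
  by rewrite invfM mulrA mulfV ?mul1r.
have intS : (\int[mu]_(x in D) S x <= 2%:E)%E.
  rewrite integral_nneseries//.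
  apply: (@le_trans _ _ (\sum_(0 <= n <oo) (2 / (2 ^ (n + 1))%:R)%:E)%E).
    by apply: lee_nneseries => // n _ _; apply: integral_ge0; exact: h0.
  have /cvg_lim -> // := @cvg_geometric_eseries_half R 2 0.
  by rewrite expr0 divr1.
have iS : mu.-integrable D S.
  apply/integrableP; split => //; apply: le_lt_trans (ltry 2).
  by rewrite (eq_integral S)// => x /set_mem Dx; rewrite gee0_abs// S0.
pose N := D `&` [set x | S x \is a fin_num].
have mN : measurable N by exact: emeasurable_fin_num.
have mN' : measurable (D `\` N) by exact: measurableD.
have N0 : mu (D `\` N) = 0.
  apply: measure_negligible => //.
  apply: negligibleS (integrable_ae mD iS) => x [Dx Nx] /=.
  by move=> /(_ Dx) Sx; apply: Nx.
have fcvg x : N x -> cvgn (fun n => f n x).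
  move=> [Dx Sx]; set M := fine (S x).
  have M0 : 0 <= M by rewrite fine_ge0// S0.
  have hM n : 4%:R ^+ n * sub (f n) (f n.+1) x ^+ 2 <= M.
    rewrite -lee_fin fineK//.
    apply: le_trans (@nneseries_lim_ge _ (h ^~ x) xpredT 0%N n.+1 _); last first.
      by move=> k _ _; exact: h0.
    rewrite big_nat_recr//= leeDr// sume_ge0// => k _; exact: h0.
  have dM n : `|f n.+1 x - f n x| <= geometric (M + 1) 2^-1 n.
    rewrite /geometric/= exprVn ler_pdivlMr ?exprn_gt0//.
    rewrite -[leLHS]ger0_norm ?mulr_ge0 ?exprn_ge0// -[leRHS]ger0_norm ?addr_ge0//.
    rewrite -ler_sqr ?nnegrE// !real_normK ?num_real//.
    apply: (@le_trans _ _ M); last by nra.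
    apply: le_trans (hM n).
    rewrite exprMn real_normK ?num_real// -exprM mulnC exprM.
    by rewrite (_ : 2%:R ^+ 2 = 4%:R :> R) /lin; [lra|ring].
  have cs : cvgn (series (telescope (f ^~ x))).
    apply: normed_cvg; apply: (@series_le_cvg _ _ (geometric (M + 1) 2^-1)).
    - by move=> n; exact: normr_ge0.
    - by move=> n; rewrite /geometric/= mulr_ge0 ?addr_ge0// exprn_ge0.
    - exact: dM.
    - by apply: is_cvg_geometric_series; rewrite ger0_norm ?invr_ge0// invf_lt1 ?ltr1n.
  have -> : (fun n => f n x) = (fun n => f 0%N x + series (telescope (f ^~ x)) n).
    by apply/funext => n; rewrite -eq_sum_telescope.
  by apply: is_cvgD => //; exact: is_cvg_cst.
(* Setting the sequence to 0 off [N] makes it converge everywhere on [D], which gives a measurable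
   limit. *)
pose f' n x := f n x * \1_N x.
have f'cvg x : D x -> cvgn (fun n => f' n x).
  move=> Dx; have [/set_mem Nx|xN] := boolP (x \in N).
    rewrite /f' indicE mem_set//= (_ : (fun _ => _) = f ^~ x); first exact: fcvg.
    by apply/funext => n; rewrite mulr1.
  rewrite /f' indicE (negbTE xN) (_ : (fun _ => _) = cst 0); first exact: is_cvg_cst.
  by apply/funext => n; rewrite mulr0.
pose g x := limn (fun n => f' n x).
have mg : measurable_fun D g.
  apply: (@measurable_fun_cvg _ _ _ _ f') => [n|x Dx]; last exact: f'cvg.
  by apply: measurable_funM; [exact: (Lf n).1|exact: measurable_indic].
have fg x : N x -> f n x @[n --> \oo] --> g x.
  move=> Nx; have := f'cvg x Nx.1.
  rewrite /g /f' indicE mem_set//= (_ : (fun _ => _) = f ^~ x)//.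
  by apply/funext => n; rewrite mulr1.
(* Fatou's lemma in the second index, on the set [N] of full measure where the sequence converges to
   g. *)
have key n : (\int[mu]_(x in D) ((sub (f n) g x) ^+ 2)%:E <= (8%:R ^- n)%:E)%E.
  have ms u : measurable_fun D u ->
      measurable_fun D (fun x => ((sub (f n) u x) ^+ 2)%:E).
    move=> mu'; apply/measurable_EFinP/measurable_funX.
    by apply: measurable_funD; apply: measurable_funM => //; exact: (Lf n).1.
  have s0 u x : D x -> (0 <= ((sub (f n) u x) ^+ 2)%:E)%E.
    by move=> _; rewrite lee_fin sqr_ge0.
  rewrite (ge0_negligible_integral mN' mD (ms _ mg) (s0 g) N0).
  have -> : D `\` (D `\` N) = N by rewrite setDD setIC; apply/setIidPl => x [].
  have NE : {in N, (fun x => ((sub (f n) g x) ^+ 2)%:E) =1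
     (fun x => limn_einf (fun m => ((sub (f n) (f m) x) ^+ 2)%:E))}.
    move=> x /set_mem Nx.
    suff /cvg_limn_einf_sup[-> _] :
      ((sub (f n) (f m) x) ^+ 2)%:E @[m --> \oo] --> ((sub (f n) g x) ^+ 2)%:E by [].
    apply: cvg_EFin; first exact: nearW.
    apply: (@cvgM _ _ _ _ (fun m => sub (f n) (f m) x) (fun m => sub (f n) (f m) x));
    by apply: cvgD; [exact: cvg_cst|apply: cvgM; [exact: cvg_cst|exact: fg]].
  rewrite (eq_integral _ _ NE).
  apply: le_trans (fatou _ mN _ _) _.
  - by move=> m; apply: measurable_funS (ms _ (Lf m).1) => // x [].
  - by move=> m x [Dx _]; exact: s0.
  rewrite limn_einf_lim; apply: lime_le; first exact: is_cvg_einfs.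
  apply: nearW => m; apply: (@le_trans _ _
    (\int[mu]_(x in N) ((sub (f n) (f (maxn n m)) x) ^+ 2)%:E)%E).
    by apply: ereal_inf_lbound; exists (maxn n m) => //=; exact: leq_maxr.
  apply: (@le_trans _ _
    (\int[mu]_(x in D) ((sub (f n) (f (maxn n m)) x) ^+ 2)%:E)%E).
    apply: ge0_subset_integral => //; last by move=> x [].
      exact: (ms _ (Lf _).1).
    by move=> x Dx; exact: s0.
  by rewrite dotE// lee_fin Cf// leq_maxl.
have Ls n : L2 (sub (f n) g).
  split; last by rewrite (le_lt_trans (key n))// ltry.
  by apply: measurable_funD; apply: measurable_funM => //; exact: (Lf n).1.
exists g.
  have -> : g = (lin 1 (-1) (f 0%N) (sub (f 0%N) g)).
    by apply/funext => x; rewrite /lin; ring.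
  exact: L2_lin.
by move=> n; rewrite -lee_fin -dotE.
Qed.
End L2_complete.

(** * Minimizing sequences for the quotient of two quadratic forms *)

Fact gap_norm_bound (R : realDomainType) (t B m x : R) : 0 <= t -> 0 <= B -> 0 <= m ->
  x <= 8 * t * B -> x <= t * (1 + 8 * B + 4 + 8 * m * B).
Proof.
move=> t0 B0 m0; have := mulr_ge0 m0 (mulr_ge0 t0 B0).
move=> h /le_trans; apply; rewrite -subr_ge0.
by rewrite (_ : _ - _ = 5 * t + 8 * (m * (t * B))); [lra|ring].
Qed.

Fact gap_energy_bound (R : realDomainType) (t B m x y : R) : 0 <= t -> 0 <= B -> 0 <= m ->
  x <= 8 * t * B -> y <= 4 * t + m * x -> y <= t * (1 + 8 * B + 4 + 8 * m * B).
Proof.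
move=> t0 B0 m0 h /le_trans; apply; have := ler_wpM2l m0 h.
have := mulr_ge0 t0 B0 => tB; rewrite -subr_ge0 => {}h; rewrite -subr_ge0.
by rewrite (_ : _ - _ = (m * (8 * t * B) - m * x) + t + 8 * (t * B)); [lra|ring].
Qed.

Section forms.
Context (R : realType) (T : Type) (V : set (T -> R)).

Definition psd_form (a : (T -> R) -> (T -> R) -> R) :=
  [/\ forall u v, a u v = a v u,
      forall s t u v w, V u -> V v -> V w ->
        a (lin s t u v) w = s * a u w + t * a v w
    & forall u, V u -> 0 <= a u u].

Hypothesis Vlin : forall s t u v, V u -> V v -> V (lin s t u v).

Lemma form_lin a s t u v : psd_form a -> V u -> V v ->
  a (lin s t u v) (lin s t u v) =
  s ^+ 2 * a u u + 2 * s * t * a u v + t ^+ 2 * a v v.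
Proof.
move=> [aC al _] Vu Vv; have Vuv := Vlin s t Vu Vv.
by rewrite al// [a u _]aC [a v (lin _ _ _ _)]aC !al// [a v u]aC; ring.
Qed.

Variables a b : (T -> R) -> (T -> R) -> R.
Hypotheses (fa : psd_form a) (fb : psd_form b).
Variables (n : nat) (l : 'I_n -> (T -> R) -> R) (mu K : R).
Hypothesis l_lin : forall i s t u v, V u -> V v ->
  l i (lin s t u v) = s * l i u + t * l i v.
Hypothesis l_bounded : forall i u, V u -> l i u ^+ 2 <= K * b u u.
Hypothesis coercive : forall u, V u ->
  mu * b u u <= a u u + \sum_(i < n) l i u ^+ 2.

(* The finite-dimensional vectors (l i (v k))_i have a convergent subsequence;
   along it coercivity and the parallelogram law make v a Cauchy sequence. The
   last clause, an approximate Euler-Lagrange equation, is the Cauchy-Schwarz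
   inequality for the nonnegative form a - m b. *)
Lemma minimizing_sequence v0 : V v0 -> 0 < b v0 v0 -> a v0 v0 < mu * b v0 v0 ->
  exists (m : R) (v : nat -> T -> R),
    [/\ m * b v0 v0 <= a v0 v0,
        forall k, V (v k),
        forall k, b (v k) (v k) = 1,
        forall k j, (k <= j)%N ->
          b (lin 1 (-1) (v k) (v j)) (lin 1 (-1) (v k) (v j)) <= 8%:R ^- k /\
          a (lin 1 (-1) (v k) (v j)) (lin 1 (-1) (v k) (v j)) <= 8%:R ^- k
      & forall k w, V w ->
          (a (v k) w - m * b (v k) w) ^+ 2 <= 8%:R ^- k * (a w w - m * b w w)].
Proof.
move=> Vv0 b0 a0.
pose S := [set a v v | v in [set v | V v /\ b v v = 1]].
have Slb : lbound S 0 by move=> _ [v [Vv _] <-]; case: fa => _ _; exact.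
have normalize v : V v -> 0 < b v v -> S (a v v / b v v).
  move=> Vv bv; pose s := (Num.sqrt (b v v))^-1.
  have s2 : s ^+ 2 = (b v v)^-1 by rewrite exprVn sqr_sqrtr// ltW.
  exists (lin s 0 v v); first split; first exact: Vlin.
    by rewrite form_lin// s2 expr0n !(mulr0, mul0r) !addr0 mulVf// gt_eqF.
  by rewrite form_lin// s2 expr0n !(mulr0, mul0r) !addr0 mulrC.
have S0 : S !=set0 by exists (a v0 v0 / b v0 v0); exact: normalize.
have Sinf : has_inf S by split=> //; exists 0.
pose m := inf S.
have m0 : 0 <= m by apply: lb_le_inf.
have mle v : V v -> m * b v v <= a v v.
  move=> Vv; have : 0 <= b v v by case: fb => _ _; exact.
  rewrite le_eqVlt => /predU1P[<-|bv]; first by rewrite mulr0; case: fa => _ _; exact.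
  by rewrite -ler_pdivlMr//; apply: ge_inf; [exists 0|exact: normalize].
have mmu : m < mu.
  apply: (@le_lt_trans _ _ (a v0 v0 / b v0 v0)); last by rewrite ltr_pdivrMr.
  by apply: ge_inf; [exists 0|exact: normalize].
have exv k : exists v, [/\ V v, b v v = 1 & a v v <= m + k.+1%:R^-1].
  have k0 : 0 < k.+1%:R^-1 :> R by rewrite invr_gt0.
  have [_ [v [Vv bv] <-] av] := inf_adherent k0 Sinf.
  by exists v; split => //; exact: ltW.
have /choice[u Hu] := exv.
(* By [l_bounded] these vectors stay in a cube, as b (u k) (u k) = 1; a coordinate t with t ^ 2 <= K
   satisfies |t| <= K + 1. *)
pose c k : 'rV[R]_n := \row_i l i (u k).
have [r [_ clr]] : exists r, ([set r : 'rV[R]_n | forall i, `[- (K + 1), K + 1]%classic (r ord0 i)]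
    `&` cluster (c @ \oo)) r.
  apply: (@rV_compact R n (fun=> `[- (K + 1), K + 1]%classic)) => [i|].
    exact: segment_compact.
  exists 0%N => // k _ i /=; rewrite mxE in_itv/= -ler_norml.
  have [Vu bu _] := Hu k; have := l_bounded i Vu; rewrite bu mulr1.
  rewrite -[l i _ ^+ 2]real_normK ?num_real// => h.
  by have := normr_ge0 (l i (u k)); nra.
(* For the difference w of two terms with slack t, coercivity will give b w w <= 8 t B and then a w
   w <= 4 t + 8 m t B. One factor dominates both; choosing the slack as 8 ^- k divided by it gives
   the rate 8 ^- k for both forms. *)
pose B := (mu - m)^-1.
have B0 : 0 < B by rewrite invr_gt0 subr_gt0.
pose kap := (1 + 8 * B + 4 + 8 * m * B)^-1.
have kap0 : 0 < kap by rewrite invr_gt0; have := mulr_ge0 m0 (ltW B0); lra.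
have kapE : kap * (1 + 8 * B + 4 + 8 * m * B) = 1.
  by rewrite mulVf// gt_eqF// -invr_gt0.
have mB := mulr_ge0 m0 (ltW B0).
pose tau k : R := kap * 8%:R ^- k.
have p8 k : 0 < 8%:R ^- k :> R by rewrite invr_gt0 exprn_gt0.
have p8le k j : (k <= j)%N -> 8%:R ^- j <= 8%:R ^- k :> R.
  by move=> kj; rewrite lef_pV2 ?posrE ?exprn_gt0// ler_weXn2l// ler1n.
have tau0 k : 0 < tau k by rewrite mulr_gt0.
have tau8 k : tau k <= 8%:R ^- k by rewrite /tau ger_pMl//; nra.
have tE k : tau k * (1 + 8 * B + 4 + 8 * m * B) = 8%:R ^- k.
  by rewrite /tau mulrAC kapE mul1r.
(* Far enough along the sequence the excess of energy is below tau k, and closeness to the cluster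
   point within [e] in each of the n coordinates suffices because n e ^ 2 <= tau k. *)
have exj k : exists j, a (u j) (u j) <= m + tau k /\
    \sum_(i < n) (l i (u j) - r ord0 i) ^+ 2 <= tau k.
  pose e := tau k / n.+1%:R.
  have e0 : 0 < e by rewrite divr_gt0.
  have : (c @ \oo) (c @` [set j | (Num.truncn (tau k)^-1 <= j)%N]).
    by exists (Num.truncn (tau k)^-1) => // j /= ij; exists j.
  move=> /clr /(_ (nbhsx_ballx r e e0)) [_ [[j /= kj <-] rj]].
  exists j; split.
    have [_ _ aj] := Hu j; apply: (le_trans aj); rewrite lerD2l.
    rewrite invf_ple ?posrE//.
    have := truncnS_gt (tau k)^-1.
    by move=> /ltW /le_trans; apply; rewrite ler_nat ltnS.
  apply: (@le_trans _ _ (\sum_(i < n) e ^+ 2)).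
    apply: ler_sum => i _; have := rj.2 ord0 i; rewrite /ball/= mxE => h.
    rewrite -[leLHS]real_normK ?num_real// distrC.
    by rewrite lerXn2r ?nnegrE// ltW.
  rewrite sumr_const card_ord -mulr_natl /e expr_div_n.
  have t1 : tau k <= 1.
    by rewrite (le_trans (tau8 k))// invf_le1 ?exprn_gt0// exprn_ege1// ler1n.
  have nn : (n%:R : R) <= n.+1%:R ^+ 2.
    by rewrite -natrX ler_nat expnS expn1 (leq_trans (leqnSn n))// leq_pmulr.
  rewrite mulrA ler_pdivrMr ?exprn_gt0//.
  rewrite (_ : _ * tau k ^+ 2 = tau k * (n%:R * tau k)); last by ring.
  by rewrite ler_pM2l// (le_trans _ nn)// ler_piMr.
have /choice[j Hj] := exj.
exists m, (u \o j); split => /=.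
- exact: mle.
- by move=> k; case: (Hu (j k)).
- by move=> k; case: (Hu (j k)).
- move=> k k' kk'.
  have [Vk bk _] := Hu (j k); have [Vk' bk' _] := Hu (j k').
  set w := lin 1 (-1) _ _; have Vw : V w by exact: Vlin.
  have [ak lk] := Hj k; have [ak' lk'] := Hj k'.
  have Vs : V (lin 1 1 (u (j k)) (u (j k'))) by exact: Vlin.
  have ms := mle _ Vs; rewrite !form_lin// bk bk' in ms.
  (* Parallelogram law: a of the sum is at least m times b of the sum, and the latter is 4 - b w
     w. *)
  have aw : a w w <= 4 * tau k + m * b w w.
    rewrite !form_lin// bk bk'.
    have : tau k' <= tau k by rewrite ler_pM2l// p8le.
    by nra.
  have lw : \sum_(i < n) l i w ^+ 2 <= 4 * tau k.
    apply: (@le_trans _ _ (\sum_(i < n) (2 * (l i (u (j k)) - r ord0 i) ^+ 2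
        + 2 * (l i (u (j k')) - r ord0 i) ^+ 2))).
      apply: ler_sum => i _; rewrite l_lin//.
      have := sqr_ge0 (l i (u (j k)) - r ord0 i + (l i (u (j k')) - r ord0 i)).
      nra.
    rewrite big_split/= -!mulr_sumr.
    have : tau k' <= tau k by rewrite ler_pM2l// p8le.
    by lra.
  have := coercive Vw => cw.
  (* Coercivity and the two preceding bounds give (mu - m) b w w <= 8 tau k. *)
  have bw : b w w <= 8 * tau k * B.
    by rewrite -ler_pdivrMr ?invr_gt0 ?subr_gt0// invrK; nra.
  rewrite -tE; split; first by apply: gap_norm_bound bw => //; exact: ltW.
  by apply: gap_energy_bound bw aw => //; exact: ltW.
- move=> k w Vw; have [Vk bk _] := Hu (j k); have [ak _] := Hj k.
  set v := u (j k) in Vk bk ak *.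
  apply: (@le_trans _ _ ((a v v - m * b v v) * (a w w - m * b w w))); last first.
    rewrite ler_wpM2r ?subr_ge0 ?mle//.
    by rewrite bk mulr1 lerBlDl (le_trans ak)// lerD2l.
  apply: discriminant_le; rewrite ?subr_ge0 ?mle// => t.
  have := mle _ (Vlin 1 t Vk Vw); rewrite !form_lin//.
  by rewrite -subr_ge0; congr (0 <= _); ring.
Qed.

End forms.

(** * Measurability in the plane and Fubini's theorem on bounded rectangles *)

Section plane_measurability.
Context (R : realType).

(** The sigma-algebra is the product one, while openness refers to the product topology; the
    countably many rational boxes relate the two. *)
Lemma open_measurable_plane (U : set (R * R)) : open U -> measurable U.
Proof.
move=> oU.
pose box (i : rat * rat * nat) : set (R * R) :=
  ball (ratr i.1.1 : R) i.2.+1%:R^-1 `*` ball (ratr i.1.2 : R) i.2.+1%:R^-1.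
have -> : U = \bigcup_i (if `[< box i `<=` U >] then box i else set0).
  apply/seteqP; split => [[x y] Uxy|p [i _]]; last first.
    by case: ifPn => // /asboolP; exact.
  have /nbhs_ballP[e /= e0 be] := open_nbhs_nbhs (conj oU Uxy).
  pose n := Num.truncn (2 / e).
  have n0 : 0 < n.+1%:R^-1 :> R by rewrite invr_gt0.
  have ne : n.+1%:R^-1 + n.+1%:R^-1 < e.
    have : 2 / e < n.+1%:R by exact: truncnS_gt.
    rewrite ltr_pdivrMr// (_ : _^-1 + _ = 2 / n.+1%:R); last by ring.
    by rewrite ltr_pdivrMr// mulrC.
  have near_rat z : exists q : rat, ball (ratr q : R) n.+1%:R^-1 z.
    have zz : z - n.+1%:R^-1 < z + n.+1%:R^-1.
      by rewrite ltrBlDr -addrA ltrDl addr_gt0.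
    have [q] := rat_in_itvoo zz.
    rewrite in_itv/= => h; exists q; rewrite /ball/= ltr_distlC.
    by rewrite ltrBlDr ltrBDr in h *; rewrite andbC.
  have [q1 h1] := near_rat x; have [q2 h2] := near_rat y.
  exists ((q1, q2), n) => //; case: ifPn => [//|/asboolP[]] [u v] [/= hu hv].
  apply: be; split => /=; apply: le_ball (ltW ne) _ _.
    exact: ball_triangle (ball_sym h1) hu.
  exact: ball_triangle (ball_sym h2) hv.
apply: countable_bigcupT_measurable; first exact: countableP.
move=> i; case: ifPn => // _; apply: measurableX; exact: measurable_ball.
Qed.

Lemma continuous_measurable_plane (f : R * R -> R) : continuous f ->
  measurable_fun setT f.
Proof.
move=> cf mT; apply: (measurability _ (RGenOInfty.measurableE R)) => //.
move=> /= _ [_ [x ->] <-]; rewrite setTI; apply: open_measurable_plane.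
by move/continuousP : cf; apply; exact: interval_open.
Qed.

End plane_measurability.

Section rectangles.
Context (R : realType).
Local Notation lam := (@lebesgue_measure R).
Variables (M : R) (I J : set R).
Hypotheses (mI : measurable I) (mJ : measurable J).
Hypotheses (IM : I `<=` `[- M, M]) (JM : J `<=` `[- M, M]).
Implicit Type g : R * R -> R.

Lemma bounded_lebesgue_lty (K : set R) : measurable K -> K `<=` `[- M, M] ->
  (lam K < +oo)%E.
Proof.
move=> mK KM; apply: (@le_lt_trans _ _ (lam `[- M, M]%classic)).
  by apply: le_measure; rewrite ?inE//; exact: measurable_itv.
rewrite lebesgue_measure_itv/=; case: ifPn => _ //.
by rewrite -EFinB ltry.
Qed.

Lemma measurable_rectangle : measurable (I `*` J).
Proof. exact: measurableX. Qed.

Lemma rectangle_lty : (leb2 R (I `*` J) < +oo)%E.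
Proof.
rewrite /leb2 product_measure1E//=.
apply: lte_mul_pinfty => //; last exact: (bounded_lebesgue_lty mJ JM).
rewrite ge0_fin_numE//; exact: (bounded_lebesgue_lty mI IM).
Qed.

Lemma continuous_plane_integrable g : continuous g ->
  (leb2 R).-integrable (I `*` J) (EFin \o g).
Proof.
move=> cg; apply: measurable_bounded_integrable.
- exact: measurable_rectangle.
- exact: rectangle_lty.
- by apply: measurable_funTS; apply: continuous_measurable_plane.
- have cK : compact (`[- M, M]%classic `*` `[- M, M]%classic : set (R * R)).
    by apply: compact_setX; exact: segment_compact.
  have := continuous_compact (continuous_subspaceT cg) cK.
  move/compact_bounded => [B [Br hB]]; exists B; split=> // x Bx p [Ip Jp].
  by apply: hB Bx _ _; exists p => //; split; [exact: IM|exact: JM].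
Qed.

Lemma continuous_integrable (K : set R) (f : R -> R) : measurable K ->
  K `<=` `[- M, M] -> continuous f -> lam.-integrable K (EFin \o f).
Proof.
move=> mK KM cf.
have : lam.-integrable `[- M, M]%classic (EFin \o f).
  apply: continuous_compact_integrable; first exact: segment_compact.
  exact: continuous_subspaceT.
by apply: integrableS => //; exact: measurable_itv.
Qed.

Lemma continuous_pair2 g x : continuous g -> continuous (fun y => g (x, y)).
Proof.
move=> cg y; apply: (@continuous_comp _ _ _ (fun y => (x, y)) g); last exact: cg.
exact: (@cvg_pair _ _ _ (nbhs y) (nbhs x) (nbhs y) _ _ _ (cst x) id (cvg_cst x) (fun _ => id)).
Qed.

Lemma continuous_pair1 g y : continuous g -> continuous (fun x => g (x, y)).
Proof.
move=> cg x; apply: (@continuous_comp _ _ _ (fun x => (x, y)) g); last exact: cg.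
exact: (@cvg_pair _ _ _ (nbhs x) (nbhs x) (nbhs y) _ _ _ id (cst y) (fun _ => id) (cvg_cst y)).
Qed.

(** Continuity on a bounded rectangle makes the function and its sections integrable, so that
    passing to real-valued integrals through [fine] loses nothing. *)
Lemma fubini_plane g : continuous g ->
  lam.-integrable I (EFin \o (fun x => \int[lam]_(y in J) g (x, y))) /\
  \int[leb2 R]_(p in I `*` J) g p =
  \int[lam]_(x in I) \int[lam]_(y in J) g (x, y).
Proof.
move=> cg; pose h := (EFin \o g) \_ (I `*` J).
have ih : (lam \x lam)%E.-integrable setT h.
  apply: (iffLR (integrable_mkcond _ _)) (continuous_plane_integrable cg).
  exact: measurable_rectangle.
have FE : fubini_F lam h =
    (EFin \o (fun x => \int[lam]_(y in J) g (x, y))) \_ I.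
  apply/funext => x; rewrite /fubini_F /h patchE.
  case: ifPn => xI; last first.
    rewrite integral0_eq// => y _; rewrite patchE; case: ifPn => //.
    by rewrite in_setX (negbTE xI).
  rewrite /= /Rintegral fineK; last first.
    apply: integrable_fin_num => //; apply: continuous_integrable => //.
    exact: continuous_pair2.
  rewrite [RHS]integral_mkcond; apply: eq_integral => y _.
  by rewrite !patchE in_setX xI.
split.
  have h1 : lam.-integrable setT (fubini_F lam h) := integrable_fubini_F ih.
  rewrite FE in h1.
  by apply: (iffRL (integrable_mkcond _ _)) h1.
have h2 : (\int[lam]_x fubini_F lam h x = \int[leb2 R]_z h z)%E.
  exact: integral12_prod_meas1 ih.
rewrite FE in h2; rewrite /Rintegral; congr fine.
by rewrite integral_mkcond [RHS]integral_mkcond; exact: esym h2.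
Qed.

End rectangles.

Lemma fubini_plane_swap (R : realType) (M : R) (I J : set R) (g : R * R -> R)
    (lam := @lebesgue_measure R) : measurable I -> measurable J ->
  I `<=` `[- M, M] -> J `<=` `[- M, M] -> continuous g ->
  lam.-integrable J (EFin \o (fun y => \int[lam]_(x in I) g (x, y))) /\
  \int[leb2 R]_(p in I `*` J) g p =
  \int[lam]_(y in J) \int[lam]_(x in I) g (x, y).
Proof.
move=> mI mJ IM JM cg; split.
  have cs : continuous (fun p : R * R => g (p.2, p.1)).
    move=> p; apply: (@continuous_comp _ _ _ (fun p : R * R => (p.2, p.1)) g).
      exact: (@cvg_pair _ _ _ (nbhs p) (nbhs p.2) (nbhs p.1) _ _ _ snd fst
        cvg_snd cvg_fst).
    exact: cg.
  by have [] := fubini_plane mJ mI JM IM cs.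
 pose h := (EFin \o g) \_ (I `*` J).
have ih : (lam \x lam)%E.-integrable setT h.
  apply: (iffLR (integrable_mkcond _ _)) (continuous_plane_integrable mI mJ IM JM cg).
  exact: measurable_rectangle.
have GE : fubini_G lam h =
    (EFin \o (fun y => \int[lam]_(x in I) g (x, y))) \_ J.
  apply/funext => y; rewrite /fubini_G /h patchE.
  case: ifPn => yJ; last first.
    rewrite integral0_eq// => x _; rewrite patchE; case: ifPn => //.
    by rewrite in_setX (negbTE yJ) andbF.
  rewrite /= /Rintegral fineK; last first.
    apply: integrable_fin_num => //; apply: (continuous_integrable mI IM) => //.
    exact: continuous_pair1.
  rewrite [RHS]integral_mkcond; apply: eq_integral => x _.
  by rewrite !patchE in_setX yJ andbT.
have h2 : (\int[lam]_x fubini_G lam h x = \int[leb2 R]_z h z)%E.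
  exact: integral21_prod_meas1 ih.
rewrite GE in h2; rewrite /Rintegral; congr fine.
by rewrite integral_mkcond [RHS]integral_mkcond; exact: esym h2.
Qed.

(** * Poincare's inequality on rectangles and on their dyadic subdivisions *)

Section variance.
Context d (T : measurableType d) (R : realType).
Variables (mu : {measure set T -> \bar R}) (D : set T) (m : R).
Hypotheses (mD : measurable D) (m0 : 0 < m) (muD : mu D = m%:E).

Lemma bounded_L2 (f : T -> R) (B : R) : measurable_fun D f ->
  (forall x, D x -> f x ^+ 2 <= B) -> L2 mu D f.
Proof.
move=> mf fB; apply/L2P; split => //.
have iB : mu.-integrable D (EFin \o cst B).
  apply: measurable_bounded_integrable => //; first by rewrite muD ltry.
  by exists `|B|; split; [exact: num_real|move=> x Bx p _ /=; exact: ltW].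
apply: (le_integrable mD _ _ iB).
  by apply/measurable_EFinP; exact: measurable_funX.
move=> x Dx /=; rewrite lee_fin ger0_norm ?sqr_ge0//.
by rewrite (le_trans (fB x Dx))// ler_norm.
Qed.

Lemma L2_cst (c : R) : L2 mu D (cst c).
Proof. exact: (@bounded_L2 _ (c ^+ 2)). Qed.

Lemma dot_cst (f : T -> R) c : L2 mu D f ->
  dot mu D f (cst c) = c * \int[mu]_(x in D) f x.
Proof.
move=> Lf; rewrite /dot -RintegralZl//.
  by apply: eq_Rintegral => x _; rewrite mulrC.
have := L2_mul_integrable mD Lf (L2_cst 1).
by apply: eq_integrable => // x _ /=; rewrite mulr1.
Qed.

Lemma dot_cst1 (c : R) : \int[mu]_(x in D) c = c * m.
Proof. by rewrite Rintegral_cst// muD. Qed.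

(* Integrating (f s - f t)^2 <= K in s, by Cauchy-Schwarz, bounds the distance
   of f t to the mean of f. *)
Lemma variance_le (f : T -> R) (K : R) : measurable_fun D f ->
  (forall s t, D s -> D t -> (f s - f t) ^+ 2 <= K) ->
  L2 mu D f /\ dot mu D f f <= (\int[mu]_(x in D) f x) ^+ 2 / m + m * K.
Proof.
move=> mf fK.
have Lf : L2 mu D f.
  have [D0|/nonemptyPn D0] := pselect (D !=set0); last first.
    by move: muD; rewrite D0 measure0 => -[] m0'; move: m0; rewrite -m0' ltxx.
  case: D0 => t Dt; apply: (@bounded_L2 _ (2 * f t ^+ 2 + 2 * K)) => // s Ds.
  by have := fK s t Ds Dt; have := sqr_ge0 (f s - 2 * f t); nra.
split=> //.
pose S := \int[mu]_(x in D) f x; rewrite -/S.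
have L1 := L2_cst 1.
have key t : D t -> (f t - S / m) ^+ 2 <= K.
  move=> Dt; pose G := lin (- 1) (f t) f (cst 1).
  have LG : L2 mu D G by exact: L2_lin.
  have := cauchy_schwarz mD LG L1.
  have -> : dot mu D (cst 1) (cst 1) = m.
    by rewrite dot_cst// dot_cst1 !mul1r.
  rewrite {1}/G dotDl// [dot _ _ f (cst _)]dot_cst// [dot _ _ (cst _) _]dot_cst//.
  rewrite dot_cst1 -/S !mul1r.
  have dG : dot mu D G G <= K * m.
    rewrite -dot_cst1; apply: le_Rintegral => //.
    - exact: L2_mul_integrable.
    - have := L2_mul_integrable mD (L2_cst K) L1.
      by apply: eq_integrable => // x _ /=; rewrite mulr1.
    - move=> s Ds; rewrite -expr2 /G/= /lin/=.
      by have := fK t s Dt Ds; rewrite mulr1 mulN1r addrC.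
  move=> h; have {}h := le_trans h (ler_wpM2r (ltW m0) dG).
  rewrite -(@ler_pM2r _ (m ^+ 2)) ?exprn_gt0// -exprMn mulrBl divfK ?gt_eqF//.
  by apply: le_trans (le_trans h _); rewrite ?mulN1r 1?addrC// -mulrA expr2.
have LF : L2 mu D (lin 1 (- (S / m)) f (cst 1)) by exact: L2_lin.
have : dot mu D (lin 1 (- (S / m)) f (cst 1)) (lin 1 (- (S / m)) f (cst 1))
    <= K * m.
  rewrite -dot_cst1; apply: le_Rintegral => //.
  - exact: L2_mul_integrable.
  - have := L2_mul_integrable mD (L2_cst K) L1.
    by apply: eq_integrable => // x _ /=; rewrite mulr1.
  - by move=> s Ds; rewrite -expr2 /lin/= mulr1 mul1r; exact: key.
rewrite (dot_sqr_lin mD _ Lf L1) dot_cst// dot_cst// dot_cst1 -/S.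
rewrite -subr_ge0 => h; rewrite -subr_ge0; apply: (le_trans h).
by rewrite le_eqVlt; apply/orP; left; apply/eqP; field; rewrite gt_eqF.
Qed.

End variance.

Lemma Rintegral_subset_le d (T : measurableType d) (R : realType)
    (mu : {measure set T -> \bar R}) (A B : set T) (f : T -> R) :
  measurable A -> measurable B -> A `<=` B -> mu.-integrable B (EFin \o f) ->
  (forall x, B x -> 0 <= f x) ->
  \int[mu]_(x in A) f x <= \int[mu]_(x in B) f x.
Proof.
move=> mA mB AB iB f0; apply: fine_le.
- by apply: integrable_fin_num => //; exact: integrableS iB.
- exact: integrable_fin_num.
- by apply: ge0_subset_integral => //; exact: measurable_int iB.
Qed.

Lemma itv_co_integrable (R : realType) (f : R -> R) (a b : R) : continuous f ->
  (@lebesgue_measure R).-integrable `[a, b[%classic (EFin \o f).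
Proof.
move=> cf.
have : (@lebesgue_measure R).-integrable `[a, b]%classic (EFin \o f).
  apply: continuous_compact_integrable; first exact: segment_compact.
  exact: continuous_subspaceT.
apply: integrableS; [exact: measurable_itv|exact: measurable_itv|].
by move=> x /=; rewrite !in_itv/= => /andP[-> /ltW].
Qed.

(** The fundamental theorem of calculus and Cauchy-Schwarz on [s, t]. Intervals are half-open
    because these tile without overlap when a rectangle is subdivided. *)
Lemma increment_le (R : realType) (f df : R -> R) (a b s t : R) :
  (forall x : R, is_derive x 1 f (df x)) -> continuous df ->
  a <= s < b -> a <= t < b ->
  (f t - f s) ^+ 2 <=
    (b - a) * \int[lebesgue_measure]_(x in `[a, b[) (df x ^+ 2).
Proof.
move=> f' cdf; wlog st : s t / s < t.
  move=> H hs ht; have [/H| ts|->] := ltgtP s t; first exact.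
    by rewrite -sqrrN opprB; exact: H.
  rewrite subrr expr0n/= mulr_ge0//.
    by rewrite subr_ge0 ltW//; case/andP: ht => /le_lt_trans; apply.
  by apply: Rintegral_ge0 => x _; exact: sqr_ge0.
move=> /andP[as_ sb] /andP[at_ tb].
pose lam := @lebesgue_measure R.
have mst : measurable (`[s, t]%classic : set (measurableTypeR R)) by exact: measurable_itv.
have lst : lam `[s, t]%classic = (t - s)%:E.
  by rewrite /lam lebesgue_measure_itv/= lte_fin st.
have ts0 : 0 < t - s by rewrite subr_gt0.
have cf : continuous f.
  by move=> x; apply: differentiable_continuous; apply/derivable1_diffP; case: (f' x).
have FTC : \int[lam]_(x in `[s, t]) df x = f t - f s.
  rewrite /Rintegral (@continuous_FTC2 _ df f)//.
  - exact: continuous_subspaceT.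
  - split.
    + by move=> x _; case: (f' x).
    + exact/cvg_at_right_filter/cf.
    + exact/cvg_at_left_filter/cf.
  - by move=> x _; rewrite derive1E; exact: derive_val.
have Ldf : L2 lam `[s, t]%classic df.
  apply/L2P; split.
    by apply: measurable_funTS; exact: continuous_measurable_fun.
  apply: continuous_compact_integrable; first exact: segment_compact.
  by apply: continuous_subspaceT => x; apply: cvgM; exact: cdf.
have := cauchy_schwarz mst Ldf (L2_cst mst lst 1).
rewrite !(dot_cst mst lst)//; last exact: (L2_cst mst lst 1).
rewrite (dot_cst1 mst lst) !mul1r FTC => h.
apply: (le_trans h); rewrite mulrC.
apply: ler_pM => //.
- exact: ltW.
- exact: dot_ge0.
- by rewrite lerB// ltW.
rewrite /dot; apply: Rintegral_subset_le => //.
- by move=> x /=; rewrite !in_itv/= => /andP[sx xt]; rewrite (le_trans as_)//= (le_lt_trans xt).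
- by apply: itv_co_integrable => x; apply: cvgM; exact: cdf.
- by move=> x _; rewrite -expr2 sqr_ge0.
Qed.

Definition plane_C1 (R : realType) (v vx vy : R * R -> R) :=
  [/\ continuous v, continuous vx, continuous vy,
      forall x y : R, is_derive x 1 (fun s => v (s, y)) (vx (x, y))
    & forall x y : R, is_derive y 1 (fun s => v (x, s)) (vy (x, y))].

Lemma continuous_sqr (R : realType) (T : topologicalType) (f : T -> R) :
  continuous f -> continuous (fun x => f x ^+ 2).
Proof. by move=> cf x; apply: (@cvgM _ _ _ _ f f); exact: cf. Qed.

Section poincare.
Context (R : realType) (a b c e : R).
Hypotheses (ab : a < b) (ce : c < e).
Local Notation lam := (@lebesgue_measure R).
Let M := `|a| + `|b| + `|c| + `|e|.
Local Notation I := (`[a, b[%classic : set (measurableTypeR R)).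
Local Notation J := (`[c, e[%classic : set (measurableTypeR R)).

Let mI : measurable I. Proof. exact: measurable_itv. Qed.
Let mJ : measurable J. Proof. exact: measurable_itv. Qed.

Let IM : I `<=` `[- M, M].
Proof.
move=> x /=; rewrite !in_itv/= /M => /andP[ax xb].
have := ler_norm b; have := ler_norm (- a); rewrite normrN.
have := normr_ge0 a; have := normr_ge0 b; have := normr_ge0 c.
by have := normr_ge0 e => *; apply/andP; split; lra.
Qed.

Let JM : J `<=` `[- M, M].
Proof.
move=> x /=; rewrite !in_itv/= /M => /andP[ax xb].
have := ler_norm e; have := ler_norm (- c); rewrite normrN.
have := normr_ge0 a; have := normr_ge0 b; have := normr_ge0 c.
by have := normr_ge0 e => *; apply/andP; split; lra.
Qed.

Let lI : lam I = (b - a)%:E.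
Proof. by rewrite lebesgue_measure_itv/= lte_fin ab. Qed.
Let lJ : lam J = (e - c)%:E.
Proof. by rewrite lebesgue_measure_itv/= lte_fin ce. Qed.

Lemma continuous_L2_itv (f : R -> R) (u v : R) : continuous f ->
  L2 lam `[u, v[%classic f.
Proof.
move=> cf; apply/L2P; split.
  by apply: measurable_funTS; exact: continuous_measurable_fun.
apply: itv_co_integrable; exact: continuous_sqr.
Qed.

(** [variance_le] is used twice: in y for each fixed x, and in x for the integral [F] x of v (x, y)
    over y. The oscillation of [F] is controlled by Cauchy-Schwarz in y, then [increment_le] in
    x. *)
Lemma poincare_rectangle (v vx vy : R * R -> R) : plane_C1 v vx vy ->
  \int[leb2 R]_(p in I `*` J) v p ^+ 2 <=
  (\int[leb2 R]_(p in I `*` J) v p) ^+ 2 / ((b - a) * (e - c)) +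
  (b - a) ^+ 2 * \int[leb2 R]_(p in I `*` J) vx p ^+ 2 +
  (e - c) ^+ 2 * \int[leb2 R]_(p in I `*` J) vy p ^+ 2.
Proof.
move=> [cv cvx cvy dvx dvy].
have ab0 : 0 < b - a by rewrite subr_gt0.
have ce0 : 0 < e - c by rewrite subr_gt0.
pose F x := \int[lam]_(y in J) v (x, y).
pose H x := \int[lam]_(y in J) vy (x, y) ^+ 2.
pose G := \int[leb2 R]_(p in I `*` J) vx p ^+ 2.
have [iF FE] := fubini_plane mI mJ IM JM cv.
have [iH HE] := fubini_plane mI mJ IM JM (continuous_sqr cvy).
have [iV VE] := fubini_plane mI mJ IM JM (continuous_sqr cv).
have [iG GE] := fubini_plane_swap mI mJ IM JM (continuous_sqr cvx).
rewrite -/F -/H in iF FE iH HE.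
have [LF dF] : L2 lam I F /\ dot lam I F F <=
    (\int[lam]_(x in I) F x) ^+ 2 / (b - a) + (b - a) * ((e - c) * ((b - a) * G)).
  apply: (variance_le mI ab0 lI).
    by apply/measurable_EFinP; exact: measurable_int iF.
  move=> s t Is It.
  have Lv x := continuous_L2_itv c e (@continuous_pair2 R v x cv).
  have Lst : L2 lam J (fun y => 1 * v (s, y) + -1 * v (t, y)) by exact: L2_lin.
  have -> : F s - F t = dot lam J (fun y => 1 * v (s, y) + -1 * v (t, y)) (cst 1).
    rewrite dotDl//; last exact: (L2_cst mJ lJ).
    by rewrite !(dot_cst mJ lJ)// !mul1r mulN1r.
  apply: le_trans (cauchy_schwarz mJ Lst (L2_cst mJ lJ 1)) _.
  rewrite (dot_cst mJ lJ _ (L2_cst mJ lJ 1)) (dot_cst1 mJ lJ) !mul1r mulrC ler_pM2l//.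
  rewrite /G GE -RintegralZl//; apply: le_Rintegral => //.
  - exact: L2_mul_integrable.
  - exact: (integrableZl mJ (b - a) iG).
  - move=> y Jy; rewrite -expr2 mul1r mulN1r.
    by apply: (increment_le (dvx^~ y)) => //; exact: continuous_pair1.
rewrite VE.
apply: (@le_trans _ _ (\int[lam]_(x in I) ((e - c)^-1 * (F x * F x) + (e - c) ^+ 2 * H x))).
  have iFF := L2_mul_integrable mI LF LF.
  apply: le_Rintegral => //.
    exact: (integrableD mI (integrableZl mI _ iFF) (integrableZl mI _ iH)).
  move=> x Ix.
  have [_] : L2 lam J (fun y => v (x, y)) /\
      dot lam J (fun y => v (x, y)) (fun y => v (x, y)) <=
      (F x) ^+ 2 / (e - c) + (e - c) * ((e - c) * H x).
    apply: (variance_le mJ ce0 lJ).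
      by apply: measurable_funTS; apply: continuous_measurable_fun; exact: continuous_pair2.
    move=> s t Js Jt; apply: (increment_le (dvy x)) => //.
    exact: continuous_pair2.
  rewrite /dot; under eq_Rintegral do rewrite -expr2.
  by move=> /le_trans; apply; rewrite -!expr2 mulrC mulrA -expr2.
have iFF := L2_mul_integrable mI LF LF.
rewrite RintegralD//; [|exact: (integrableZl mI _ iFF)|exact: (integrableZl mI _ iH)].
rewrite RintegralZl// RintegralZl// -HE lerD2r FE.
rewrite -(ler_pM2l ce0) mulrA mulfV ?gt_eqF// mul1r; apply: (le_trans dF).
rewrite -/G le_eqVlt; apply/orP; left; apply/eqP; field.
by rewrite !gt_eqF.
Qed.

End poincare.

Section cells.
Context (R : realType).
Implicit Types (a b c e m : R) (f v : R * R -> R).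

Definition rect a b c e : set (R * R) := `[a, b[%classic `*` `[c, e[%classic.

Lemma measurable_rect a b c e : measurable (rect a b c e).
Proof. by apply: measurableX; exact: measurable_itv. Qed.

Lemma rect_integrable a b c e f : continuous f ->
  (leb2 R).-integrable (rect a b c e) (EFin \o f).
Proof.
move=> cf; pose M := `|a| + `|b| + `|c| + `|e|.
have h := (ler_norm b, ler_norm (- a), ler_norm e, ler_norm (- c)).
rewrite !normrN in h; have p := (@normr_ge0 _ R).
have pa := p a; have pb := p b; have pc := p c; have pe := p e.
apply: (@continuous_plane_integrable _ M) => //; try exact: measurable_itv.
- move=> x /=; rewrite !in_itv/= /M => /andP[ax xb].
  by case: h => [[[? ?] ?] ?]; apply/andP; split; lra.
- move=> x /=; rewrite !in_itv/= /M => /andP[ax xb].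
  by case: h => [[[? ?] ?] ?]; apply/andP; split; lra.
Qed.

Lemma rect_splitx a m b c e f : a < m < b -> continuous f ->
  \int[leb2 R]_(p in rect a b c e) f p =
  \int[leb2 R]_(p in rect a m c e) f p + \int[leb2 R]_(p in rect m b c e) f p.
Proof.
move=> /andP[am mb] cf.
have E : rect a b c e = rect a m c e `|` rect m b c e.
  rewrite /rect (@itv_bndbnd_setU _ _ _ (BLeft m)) ?bnd_simp ?ltW//.
  by apply/seteqP; split => -[x y]; rewrite /setX /setU /mkset; tauto.
rewrite E Rintegral_setU//; try exact: measurable_rect.
  by rewrite -E; exact: rect_integrable.
apply/disj_setPS => -[x y] [[/= h _] [/= k _]].
by move: h k; rewrite !in_itv/= => /andP[_ xm] /andP[]; rewrite leNgt xm.
Qed.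

Lemma rect_splity a b c m e f : c < m < e -> continuous f ->
  \int[leb2 R]_(p in rect a b c e) f p =
  \int[leb2 R]_(p in rect a b c m) f p + \int[leb2 R]_(p in rect a b m e) f p.
Proof.
move=> /andP[cm me] cf.
have E : rect a b c e = rect a b c m `|` rect a b m e.
  rewrite /rect (@itv_bndbnd_setU _ _ (BLeft c) (BLeft m) (BLeft e)) ?bnd_simp ?ltW//.
  by apply/seteqP; split => -[x y]; rewrite /setX /setU /mkset; tauto.
rewrite E Rintegral_setU//; try exact: measurable_rect.
  by rewrite -E; exact: rect_integrable.
apply/disj_setPS => -[x y] [[/= _ h] [/= _ k]].
by move: h k; rewrite !in_itv/= => /andP[_ xm] /andP[]; rewrite leNgt xm.
Qed.

(* The corners (a, c), (b, e) of a rectangle. *)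
Let corners := (R * R * (R * R))%type.
Definition cellset (q : corners) := rect q.1.1 q.2.1 q.1.2 q.2.2.
Definition cellvol (q : corners) := (q.2.1 - q.1.1) * (q.2.2 - q.1.2).

(** Each bisection of both sides divides the gradient terms by 4, at the price of more mean values.
    The list of cells is chosen before v, so that these means are finitely many linear functionals
    of v. *)
Lemma poincare_cells n a b c e : a < b -> c < e ->
  exists s : seq corners, (forall q, q \in s ->
      0 < cellvol q /\ cellset q `<=` rect a b c e) /\
    forall v vx vy, plane_C1 v vx vy ->
      \int[leb2 R]_(p in rect a b c e) v p ^+ 2 <=
      \sum_(q <- s) (\int[leb2 R]_(p in cellset q) v p) ^+ 2 / cellvol q +
      ((b - a) / 2 ^+ n) ^+ 2 * \int[leb2 R]_(p in rect a b c e) vx p ^+ 2 +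
      ((e - c) / 2 ^+ n) ^+ 2 * \int[leb2 R]_(p in rect a b c e) vy p ^+ 2.
Proof.
elim: n a b c e => [|n IH] a b c e ab ce.
  exists [:: ((a, c), (b, e))]; split.
    move=> q; rewrite inE => /eqP ->; split; last by move=> p.
    by rewrite /cellvol/= mulr_gt0// subr_gt0.
  move=> v vx vy vC1; rewrite big_seq1 expr0 !divr1.
  exact: poincare_rectangle.
pose m := (a + b) / 2; pose k := (c + e) / 2.
have hm : a < m < b by apply/andP; split; rewrite /m; lra.
have hk : c < k < e by apply/andP; split; rewrite /k; lra.
have [am mb] := andP hm; have [ck ke] := andP hk.
have [s1 [h1 H1]] := IH a m c k am ck; have [s2 [h2 H2]] := IH a m k e am ke.
have [s3 [h3 H3]] := IH m b c k mb ck; have [s4 [h4 H4]] := IH m b k e mb ke.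
have sub a' b' c' e' : a <= a' -> b' <= b -> c <= c' -> e' <= e ->
    rect a' b' c' e' `<=` rect a b c e.
  move=> aa bb cc ee [x y] [/=]; rewrite !in_itv/= => /andP[x1 x2] /andP[y1 y2].
  split => /=; rewrite in_itv/=.
    by rewrite (le_trans aa)//= (lt_le_trans x2).
  by rewrite (le_trans cc)//= (lt_le_trans y2).
exists ((s1 ++ s2) ++ (s3 ++ s4)); split.
  move: (ltW am) (ltW mb) (ltW ck) (ltW ke) => am' mb' ck' ke'.
  by move=> q; rewrite !mem_cat => /orP[/orP[/h1|/h2]|/orP[/h3|/h4]] [q0 qs];
    split => //; apply: (subset_trans qs); apply: sub.
move=> v vx vy vC1; have [cv cvx cvy _ _] := vC1.
have split4 f : continuous f ->
    \int[leb2 R]_(p in rect a b c e) f p =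
    (\int[leb2 R]_(p in rect a m c k) f p + \int[leb2 R]_(p in rect a m k e) f p) +
    (\int[leb2 R]_(p in rect m b c k) f p + \int[leb2 R]_(p in rect m b k e) f p).
  by move=> cf; rewrite (rect_splitx c e hm)// !(rect_splity _ _ hk).
rewrite !split4; try exact: continuous_sqr.
rewrite !big_cat/=.
have := H1 _ _ _ vC1; have := H2 _ _ _ vC1; have := H3 _ _ _ vC1.
have := H4 _ _ _ vC1.
have -> : m - a = (b - a) / 2 by rewrite /m; field.
have -> : b - m = (b - a) / 2 by rewrite /m; field.
have -> : k - c = (e - c) / 2 by rewrite /k; field.
have -> : e - k = (e - c) / 2 by rewrite /k; field.
have E t : t / 2 / 2 ^+ n = t / 2 ^+ n.+1 :> R.
  by rewrite exprS invfM mulrA.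
rewrite !E; set u := ((b - a) / _) ^+ 2; set w := ((e - c) / _) ^+ 2.
lra.
Qed.

End cells.

(** * Smooth functions and test functions as linear spaces *)

Section smooth_functions.
Context (R : realType).
Implicit Types (f g u v : R * R -> R) (p : R * R).

(** Directional derivatives in the plane reduce to derivatives of one-variable functions, to which
    the usual rules of calculus apply. *)
Lemma quotient_x f (x y : R) :
  (fun h : R => h^-1 *: (f (h *: ((1 : R), (0 : R)) + (x, y)) - f (x, y))) =
  (fun h : R => h^-1 *: (f (h *: (1 : R) + x, y) - f (x, y))).
Proof.
apply/funext => h; congr (_ *: (f _ - _)).
by apply: injective_projections; rewrite //= scaler0 add0r.
Qed.

Lemma quotient_y f (x y : R) :
  (fun h : R => h^-1 *: (f (h *: ((0 : R), (1 : R)) + (x, y)) - f (x, y))) =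
  (fun h : R => h^-1 *: (f (x, h *: (1 : R) + y) - f (x, y))).
Proof.
apply/funext => h; congr (_ *: (f _ - _)).
by apply: injective_projections; rewrite //= scaler0 add0r.
Qed.

Lemma is_derive_dx f : (forall p, derivable f p ((1 : R), (0 : R))) ->
  forall x y : R, is_derive x 1 (fun s => f (s, y)) (dx f (x, y)).
Proof.
move=> df x y; have := df (x, y); rewrite /derivable quotient_x => dfx.
by split; [exact: dfx|rewrite /dx /derive quotient_x].
Qed.

Lemma is_derive_dy f : (forall p, derivable f p ((0 : R), (1 : R))) ->
  forall x y : R, is_derive y 1 (fun s => f (x, s)) (dy f (x, y)).
Proof.
move=> df x y; have := df (x, y); rewrite /derivable quotient_y => dfy.
by split; [exact: dfy|rewrite /dy /derive quotient_y].
Qed.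

Lemma smooth_plane_C1 f : smooth f -> plane_C1 f (dx f) (dy f).
Proof.
move=> sf; have [cf [d1 d2 [cdx _] [cdy _]]] := sf 1%N.
split; [exact: cf|exact: cdx|exact: cdy| |].
- exact: (is_derive_dx d1).
- exact: (is_derive_dy d2).
Qed.

Lemma derivable_lin f g p w s t : derivable f p w -> derivable g p w ->
  derivable (lin s t f g) p w.
Proof.
move=> df dg.
have -> : lin s t f g = (s *: f + t *: g) by apply/funext => q.
by apply: derivableD; apply: derivableZ.
Qed.

Lemma derive_lin f g p w s t : derivable f p w -> derivable g p w ->
  'D_w (lin s t f g) p = s * 'D_w f p + t * 'D_w g p.
Proof.
move=> df dg.
have -> : lin s t f g = (s *: f + t *: g) by apply/funext => q.
rewrite deriveD; [|exact: derivableZ|exact: derivableZ].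
by rewrite !deriveZ.
Qed.

Lemma continuous_lin f g s t : continuous f -> continuous g ->
  continuous (lin s t f g).
Proof.
move=> cf cg p; apply: (@cvgD _ _ _ _ _ (fun p => s * f p) (fun p => t * g p));
by apply: cvgM; [exact: cvg_cst|by [exact: cf|exact: cg]].
Qed.

Lemma class_C_lin k f g s t : class_C k f -> class_C k g ->
  class_C k (lin s t f g).
Proof.
elim: k f g => [|k IH] f g /= [cf Hf] [cg Hg].
  by split => //; exact: continuous_lin.
have [f1 f2 fx fy] := Hf; have [g1 g2 gx gy] := Hg.
split; first exact: continuous_lin.
split; [by move=> p; exact: derivable_lin|by move=> p; exact: derivable_lin| |].
- have -> : dx (lin s t f g) = lin s t (dx f) (dx g).
    by apply/funext => p; exact: derive_lin.
  exact: IH.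
- have -> : dy (lin s t f g) = lin s t (dy f) (dy g).
    by apply/funext => p; exact: derive_lin.
  exact: IH.
Qed.

Lemma dx_lin f g s t : smooth f -> smooth g ->
  dx (lin s t f g) = lin s t (dx f) (dx g).
Proof.
move=> /(_ 1%N)[_ [f1 _ _ _]] /(_ 1%N)[_ [g1 _ _ _]].
by apply/funext => p; exact: derive_lin.
Qed.

Lemma dy_lin f g s t : smooth f -> smooth g ->
  dy (lin s t f g) = lin s t (dy f) (dy g).
Proof.
move=> /(_ 1%N)[_ [_ f1 _ _]] /(_ 1%N)[_ [_ g1 _ _]].
by apply/funext => p; exact: derive_lin.
Qed.

Variable Om : set (R * R).

Lemma test_function_lin s t f g : test_function Om f -> test_function Om g ->
  test_function Om (lin s t f g).
Proof.
move=> [sf pf Of kf] [sg pg Og kg].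
have sub : closure [set p | lin s t f g p != 0] `<=`
    closure [set p | f p != 0] `|` closure [set p | g p != 0].
  rewrite -closureU; apply: closure_subset => p /=.
  have [f0|f0] := eqVneq (f p) 0; last by left.
  by have [g0|g0] := eqVneq (g p) 0; [rewrite /lin f0 g0 !mulr0 addr0 eqxx|right].
split.
- by move=> k; exact: class_C_lin.
- by move=> x y; rewrite /lin pf pg.
- by move=> p /sub [/Of|/Og].
- apply: (subclosed_compact _ (compactU kf kg)).
    apply: closedI; first exact: closed_closure.
    have -> : strip R = fst @^-1` `[- pi, pi]%classic.
      by apply/seteqP; split => p /=; rewrite in_itv.
    apply: closed_comp; last exact: interval_closed.
    by move=> p _; exact: cvg_fst.
  by move=> p [/sub [] ? ?]; [left|right].
Qed.

(** The complement of the closed support is a neighbourhood of p, so f is locally 0 and its partial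
    derivatives vanish too. Integrals over the cell may therefore be taken over a whole
    rectangle. *)
Lemma test_function_out f p : test_function Om f -> ~ Om p ->
  [/\ f p = 0, dx f p = 0 & dy f p = 0].
Proof.
move=> [sf _ Of _] Np.
have Nf : nbhs p (~` closure [set p | f p != 0]).
  apply: open_nbhs_nbhs; split; last by move=> /Of.
  by apply: closed_openC; exact: closed_closure.
have near0 : \near p, f p = cst 0 p.
  apply: filterS Nf => q /= Nq; apply/eqP; apply: contra_notT Nq.
  by move=> fq; apply: subset_closure.
split; first exact: nbhs_singleton near0.
  by rewrite /dx (near_eq_derive _ near0) derive_cst.
by rewrite /dy (near_eq_derive _ near0) derive_cst.
Qed.

End smooth_functions.

(** * The Dirichlet form and the construction of an eigenfunction *)

Definition plane (R : realType) : measurableType _ :=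
  (measurableTypeR R * measurableTypeR R)%type.

(* [leb2] with its measure structure attached once and for all, which spares
   costly canonical structure inference. *)
Definition mu2 (R : realType) : {measure set (plane R) -> \bar R} := leb2 R.

Fact lin_add (R : comRingType) (s t a b c d : R) :
  s * a + t * b + (s * c + t * d) = s * (a + c) + t * (b + d).
Proof. by ring. Qed.

Section ground_state.
Context (R : realType) (Om : set (R * R)) (H : R).
Hypotheses (mOm : measurable (cell Om)) (H0 : 0 < H).
Hypothesis OmH : forall p, cell Om p -> - H <= p.2 < H.
Local Notation mu := (leb2 R).
Local Notation lam := (@lebesgue_measure R).
Local Notation C := (cell Om).
Local Notation test := (test_function Om).
Implicit Types u v w : R * R -> R.
Local Opaque dx dy.

Let mC : measurable (C : set (plane R)) := mOm.

Definition cL2 u := L2 (mu2 R) C u.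
Definition cdot u v : R := dot (mu2 R) C u v.

Lemma cdotC u v : cdot u v = cdot v u.
Proof. exact: (@dotC _ _ _ (mu2 R) C u v). Qed.

Lemma cdot_ge0 u : 0 <= cdot u u.
Proof. exact: (@dot_ge0 _ _ _ (mu2 R) C u). Qed.

Lemma cdotDl s t u v w : cL2 u -> cL2 v -> cL2 w ->
  cdot (lin s t u v) w = s * cdot u w + t * cdot v w.
Proof. exact: (@dotDl _ _ _ (mu2 R) C mC u v w s t). Qed.

Lemma cL2_lin s t u v : cL2 u -> cL2 v -> cL2 (lin s t u v).
Proof. exact: (@L2_lin _ _ _ (mu2 R) C mC u v s t). Qed.

Lemma cdot_schwarz u v : cL2 u -> cL2 v -> cdot u v ^+ 2 <= cdot u u * cdot v v.
Proof. exact: (@cauchy_schwarz _ _ _ (mu2 R) C mC u v). Qed.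

Lemma cdotE u v : cdot u v = \int[mu]_(p in C) (u p * v p).
Proof. by []. Qed.

Lemma cdot_sqrE u : cdot u u = \int[mu]_(p in C) u p ^+ 2.
Proof. exact: (@eq_Rintegral _ _ _ (mu2 R) C (fun p => u p ^+ 2) _ (fun p _ => erefl)). Qed.

Local Opaque cdot.

Let X : set (measurableTypeR R) := `[- pi, pi]%classic.
Let Y : set (measurableTypeR R) := `[- H, H[%classic.
Let M : R := pi + H.

Let mX : measurable X. Proof. exact: measurable_itv. Qed.
Let mY : measurable Y. Proof. exact: measurable_itv. Qed.
Let XM : X `<=` `[- M, M].
Proof.
move=> x; rewrite /X/= !in_itv/= => /andP[x1 x2]; apply/andP; rewrite /M.
by split; move: H0; lra.
Qed.
Let YM : Y `<=` `[- M, M].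
Proof.
move=> x; rewrite /Y/= !in_itv/= => /andP[x1 x2]; apply/andP; rewrite /M.
by have := pi_ge0 R; split; lra.
Qed.

Let CXY : C `<=` X `*` Y.
Proof.
move=> p Cp; split; last by rewrite /Y/= in_itv/=; exact: OmH.
by rewrite /X/= in_itv/=; case: Cp.
Qed.

Lemma continuous_cell_L2 v : continuous v -> cL2 v.
Proof.
move=> cv; apply/L2P; split.
  apply: measurable_funS (measurableT) _ (continuous_measurable_plane cv) => //.
have := continuous_plane_integrable mX mY XM YM (continuous_sqr cv).
apply: integrableS => //; exact: (measurable_rectangle mX mY).
Qed.

Lemma integral_cell_box (v : R * R -> R) : (forall p, ~ Om p -> v p = 0) ->
  \int[mu]_(p in C) v p = \int[mu]_(p in X `*` Y) v p.
Proof.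
move=> v0; rewrite Rintegral_mkcond [RHS]Rintegral_mkcond.
apply: eq_Rintegral => p _; rewrite !patchE.
case: ifPn => [/set_mem/CXY/mem_set -> //|pC].
case: ifPn => // /set_mem[/= pX _]; rewrite v0// => Omp.
by move/negP : pC; apply; rewrite inE; split => //; move: pX; rewrite /X/= in_itv.
Qed.

(** The strip is closed at x = pi whereas rectangles are half-open; after Fubini the difference is a
    single point of the x-axis. *)
Lemma integral_cell_rect (v : R * R -> R) : continuous v ->
  (forall p, ~ Om p -> v p = 0) ->
  \int[mu]_(p in C) v p = \int[mu]_(p in rect (- pi) pi (- H) H) v p.
Proof.
move=> cv v0; rewrite integral_cell_box//.
have mX' : measurable (`[- pi, pi[%classic : set (measurableTypeR R)).
  exact: measurable_itv.
have XX : `[- pi, pi[ `<=` X.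
  by move=> x; rewrite /X/= !in_itv/= => /andP[-> /ltW].
have [iv ->] := fubini_plane mX mY XM YM cv.
have [iv' E] := fubini_plane mX' mY (subset_trans XX XM) YM cv.
by rewrite /rect E Rintegral_itv_bndo_bndc.
Qed.

Definition grad u v := cdot (dx u) (dx v) + cdot (dy u) (dy v).

Lemma test_cell_L2 v : test v -> [/\ cL2 v, cL2 (dx v) & cL2 (dy v)].
Proof.
move=> [/smooth_plane_C1[c1 c2 c3 _ _] _ _ _].
by split; exact: continuous_cell_L2.
Qed.

Lemma form_dot : psd_form test cdot.
Proof.
split; [exact: cdotC| |by move=> *; exact: cdot_ge0].
move=> s t u v w /test_cell_L2[Lu _ _] /test_cell_L2[Lv _ _] /test_cell_L2[Lw _ _].
exact: cdotDl.
Qed.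

Lemma form_grad : psd_form test grad.
Proof.
split; [by move=> u v; exact: congr2 (cdotC _ _) (cdotC _ _)| |].
  move=> s t u v w Tu Tv /test_cell_L2[_ xw yw].
  have [_ xu yu] := test_cell_L2 Tu; have [_ xv yv] := test_cell_L2 Tv.
  case: Tu => su _ _ _; case: Tv => sv _ _ _.
  rewrite /grad dx_lin// dy_lin//.
  exact: etrans (congr2 +%R (cdotDl s t xu xv xw) (cdotDl s t yu yv yw))
    (lin_add _ _ _ _ _ _).
by move=> u _; rewrite addr_ge0// cdot_ge0.
Qed.

(* A compactness statement in disguise: up to finitely many bounded linear
   functionals, the L^2 norm is an arbitrarily small multiple of the energy. *)
Lemma test_coercive (d : R) : 0 < d ->
  exists (n : nat) (h : 'I_n -> R * R -> R), (forall i, cL2 (h i)) /\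
    forall v, test v ->
      cdot v v <= \sum_(i < n) cdot v (h i) ^+ 2 + d * grad v v.
Proof.
move=> d0; have h0 := H0; pose D := Num.max (2 * pi) (2 * H).
have D1 : 2 * pi <= D by rewrite le_max lexx.
have D2 : 2 * H <= D by rewrite le_max lexx orbT.
have p0 := pi_gt0 R.
(* Here D ^ 2 / d < n + 1 <= 2 ^ n, so the squared side of the cells is at most d. *)
pose n := Num.truncn (D ^+ 2 / d).
have nd : (D / 2 ^+ n) ^+ 2 <= d.
  rewrite expr_div_n ler_pdivrMr ?exprn_gt0// mulrC -ler_pdivrMr//.
  apply: le_trans (ltW (truncnS_gt _)) _; rewrite -/n -!natrX ler_nat.
  by rewrite expnS expn1 (leq_trans (ltn_expl n (ltnSn 1)))// leq_pmulr// expn_gt0.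
have aHH : - H < H by lra.
have app : - pi < pi :> R by lra.
have small t : - t < t -> 2 * t <= D -> ((t - - t) / 2 ^+ n) ^+ 2 <= d.
  move=> t0 tD; apply: le_trans nd.
  have e0 : 0 < (2 ^+ n)^-1 :> R by rewrite invr_gt0 exprn_gt0.
  rewrite lerXn2r ?nnegrE ?mulr_ge0 ?(ltW e0)//; [lra|lra|].
  by rewrite ler_pM2r//; lra.
have [s [hs Hs]] := poincare_cells n app aHH.
pose q0 : R * R * (R * R) := (0, 0).
pose q (i : 'I_(size s)) := nth q0 s i.
(* Normalised so that the squared pairing with v is the squared integral of v over the cell divided
   by the area of the cell. *)
pose h i : R * R -> R :=
  (fun p => (Num.sqrt (cellvol (q i)))^-1 * \1_(cellset (q i)) p).
have mq i : measurable (cellset (q i)) by exact: measurable_rect.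
have hq i : 0 < cellvol (q i) /\ cellset (q i) `<=` rect (- pi) pi (- H) H.
  by apply: hs; exact: mem_nth.
have Cfin : (mu C < +oo)%E.
  apply: (le_lt_trans _ (rectangle_lty mX mY XM YM)).
  by apply: le_measure; rewrite ?inE//; exact: (measurable_rectangle mX mY).
have Lh i : cL2 (h i).
  have m1 : measurable_fun C (h i).
    by apply: measurable_funM => //; apply: measurable_indic.
  apply/L2P; split => //.
  have iB : mu.-integrable C (EFin \o cst ((Num.sqrt (cellvol (q i)))^-1 ^+ 2)).
    apply: measurable_bounded_integrable => //.
    exists `|(Num.sqrt (cellvol (q i)))^-1 ^+ 2|; split; first exact: num_real.
    by move=> x Bx p _ /=; exact: ltW Bx.
  apply: (le_integrable mC _ _ iB).
    by apply/measurable_EFinP; exact: measurable_funX.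
  move=> p _ /=; rewrite lee_fin /h exprMn normrM ler_piMr//.
  rewrite indicE; case: (_ \in _); rewrite ?expr1n ?normr1//.
  by rewrite expr0n normr0.
exists (size s), h; split=> // v Tv.
have [sv _ _ _] := Tv; have vC1 := smooth_plane_C1 sv.
have [cv cvx cvy _ _] := vC1.
have out f : continuous f -> (forall p, ~ Om p -> f p = 0) ->
    cdot f f = \int[mu]_(p in rect (- pi) pi (- H) H) f p ^+ 2.
  move=> cf f0; rewrite cdot_sqrE integral_cell_rect//.
    exact: continuous_sqr.
  by move=> p /f0 ->; rewrite expr0n.
have vout p := test_function_out Tv p.
have eV := out _ cv (fun p Np => let: And3 e _ _ := vout p Np in e).
have eX := out _ cvx (fun p Np => let: And3 _ e _ := vout p Np in e).
have eY := out _ cvy (fun p Np => let: And3 _ _ e := vout p Np in e).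
rewrite /grad eV eX eY.
apply: (le_trans (Hs _ _ _ vC1)).
have sumE : \sum_(q <- s) (\int[mu]_(p in cellset q) v p) ^+ 2 / cellvol q =
    \sum_(i < size s) cdot v (h i) ^+ 2.
  rewrite (big_nth q0) big_mkord; apply: eq_bigr => i _.
  have [q00 qs] := hq i.
  have -> : cdot v (h i) = (Num.sqrt (cellvol (q i)))^-1 *
      \int[mu]_(p in cellset (q i)) v p.
    rewrite -RintegralZl; [|exact: mq|exact: rect_integrable].
    rewrite cdotE integral_cell_box; last first.
      by move=> p /(vout p)[-> _ _]; rewrite mul0r.
    rewrite Rintegral_mkcond [RHS]Rintegral_mkcond.
    apply: eq_Rintegral => p _; rewrite !patchE /h indicE.
    have [pq|pq] := boolP (p \in cellset (q i)); last first.
      by rewrite !mulr0 if_same.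
    rewrite mulr1 mulrC; case: ifPn => // /negP[]; rewrite inE.
    have [/= p1 p2] := qs p (set_mem pq); split => //.
    by move: p1; rewrite /X/= !in_itv/= => /andP[-> /ltW].
 by rewrite exprMn exprVn sqr_sqrtr 1?mulrC// ltW.
rewrite sumE -addrA lerD2l mulrDr.
apply: lerD; apply: ler_wpM2r.
- by apply: Rintegral_ge0 => p _; exact: sqr_ge0.
- exact: small app D1.
- by apply: Rintegral_ge0 => p _; exact: sqr_ge0.
- exact: small aHH D2.
Qed.

End ground_state.

(** The residual of the limit is that of an approximant plus three approximation errors, and the
    square of a sum of four terms is at most 4 times the sum of their squares. *)
Fact four_squares (R : realDomainType) (e m ax ay av bx by' bv G px py pv : R) :
  (ax + ay - m * av) ^+ 2 <= e * G -> (ax - bx) ^+ 2 <= e * px ->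
  (ay - by') ^+ 2 <= e * py -> (av - bv) ^+ 2 <= e * pv ->
  (bx + by' - m * bv) ^+ 2 <= e * (4 * (G + px + py + m ^+ 2 * pv)).
Proof.
move=> h1 h2 h3 h4; have {}h4 := ler_wpM2l (sqr_ge0 m) h4.
have E : bx + by' - m * bv =
  (ax + ay - m * av) - (ax - bx) - (ay - by') + m * (av - bv) by ring.
rewrite E; rewrite -exprMn in h4.
move: (ax + ay - m * av) (ax - bx) (ay - by') (m * (av - bv)) h1 h2 h3 h4 =>
  a b c d h1 h2 h3 h4.
have := sqr_ge0 (a + b); have := sqr_ge0 (a + c); have := sqr_ge0 (a - d).
have := sqr_ge0 (b - c); have := sqr_ge0 (b + d); have := sqr_ge0 (c + d).
lra.
Qed.

Section eigenfunction.
Context (R : realType) (Om : set (R * R)) (H : R).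
Hypotheses (mOm : measurable (cell Om)) (H0 : 0 < H).
Hypothesis OmH : forall p, cell Om p -> - H <= p.2 < H.
Local Notation C := (cell Om).
Local Notation test := (test_function Om).
Local Notation cdot := (cdot Om).
Local Notation cL2 := (cL2 Om).
Local Notation grad := (grad Om).
Implicit Types u v w : R * R -> R.

Let mC : measurable (C : set (plane R)) := mOm.

Lemma sqr_eq0_of_geometric (x K : R) : (forall n, x ^+ 2 <= 8%:R ^- n * K) -> x = 0.
Proof.
move=> h; apply/eqP; rewrite -sqrf_eq0 eq_le sqr_ge0 andbT.
have K0 : 0 <= K by have := h 0%N; rewrite expr0 invr1 mul1r; apply: le_trans; exact: sqr_ge0.
have cvg0 : geometric K 8^-1 n @[n --> \oo] --> (0 : R).
  by apply: cvg_geometric; rewrite ger0_norm ?invr_ge0// invf_lt1// ltr1n.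
rewrite -(cvg_lim _ cvg0)//; apply: limr_ge; first by apply/cvg_ex; exists 0.
by apply: nearW => n; rewrite /geometric/= exprVn mulrC.
Qed.

Lemma cdot_cauchy (f : nat -> R * R -> R) : (forall n, cL2 (f n)) ->
  (forall k j, (k <= j)%N ->
     cdot (lin 1 (-1) (f k) (f j)) (lin 1 (-1) (f k) (f j)) <= 8%:R ^- k) ->
  exists2 g, cL2 g &
    forall k, cdot (lin 1 (-1) (f k) g) (lin 1 (-1) (f k) g) <= 8%:R ^- k.
Proof. exact: (@L2_complete _ _ _ (mu2 R) C mC f). Qed.

Lemma cvg_L2_geometric (f : nat -> R * R -> R) g : (forall n, cL2 (f n)) -> cL2 g ->
  (forall k, cdot (lin 1 (-1) (f k) g) (lin 1 (-1) (f k) g) <= 8%:R ^- k) ->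
  cvg_L2 Om f g.
Proof.
move=> Lf Lg fg; rewrite /cvg_L2.
have E n : (\int[leb2 R]_(p in C) ((f n p - g p) ^+ 2)%:E)%E =
    (cdot (lin 1 (-1) (f n) g) (lin 1 (-1) (f n) g))%:E.
  rewrite -(@dotE _ _ _ (mu2 R) C (lin 1 (-1) (f n) g)); last exact: cL2_lin.
  by apply: eq_integral => p _; rewrite /lin mul1r mulN1r.
rewrite (_ : (fun n => _) =
    (fun n => (cdot (lin 1 (-1) (f n) g) (lin 1 (-1) (f n) g))%:E)); last first.
  by apply/funext.
apply: cvg_EFin; first exact: nearW.
apply: (@squeeze_cvgr _ _ _ _ (cst 0) (geometric 1 8^-1)).
- by apply: nearW => n; rewrite cdot_ge0/= /geometric/= mul1r exprVn.
- exact: cvg_cst.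
- by apply: cvg_geometric; rewrite ger0_norm ?invr_ge0// invf_lt1// ltr1n.
Qed.

Lemma cdot_lim_le (f g w : R * R -> R) n : cL2 f -> cL2 g -> cL2 w ->
  cdot (lin 1 (-1) f g) (lin 1 (-1) f g) <= 8%:R ^- n ->
  (cdot f w - cdot g w) ^+ 2 <= 8%:R ^- n * cdot w w.
Proof.
move=> Lf Lg Lw h; have L := cL2_lin mOm 1 (-1) Lf Lg.
have := cdot_schwarz mOm L Lw; rewrite (cdotDl mOm 1 (-1) Lf Lg Lw) mul1r mulN1r.
by move=> /le_trans; apply; apply: ler_wpM2r h; exact: cdot_ge0.
Qed.

(** The number m given by [minimizing_sequence] is at most the quotient of phi, and the limit of the
    sequence is a nonzero eigenfunction for it, so m belongs to the set whose infimum is taken. *)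
Lemma eigenvalue1_le phi : test phi -> 0 < cdot phi phi ->
  (dirichlet_eigenvalue Om 1 <= (grad phi phi / cdot phi phi)%:E)%E.
Proof.
move=> Tphi b0.
have g0 : 0 <= grad phi phi by case: (form_grad mOm H0 OmH) => _ _; exact.
(* With this d the coercivity threshold 1 / d exceeds the Rayleigh quotient of phi, as
   [minimizing_sequence] demands. *)
pose d := cdot phi phi / (grad phi phi + 1).
have g1 : 0 < grad phi phi + 1 by rewrite ltr_wpDl.
have d0 : 0 < d by rewrite divr_gt0.
have [n [h [Lh Hh]]] := test_coercive mOm H0 OmH d0.
pose l i v := (Num.sqrt d)^-1 * cdot v (h i).
pose K := \sum_(i < n) d^-1 * cdot (h i) (h i).
have sd : (Num.sqrt d)^-1 ^+ 2 = d^-1 by rewrite exprVn sqr_sqrtr// ltW.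
have tL v : test v -> [/\ cL2 v, cL2 (dx v) & cL2 (dy v)].
  by move=> Tv; exact: (test_cell_L2 mOm H0 OmH).
have l_lin i s t u v : test u -> test v ->
    l i (lin s t u v) = s * l i u + t * l i v.
  move=> /tL[Lu _ _] /tL[Lv _ _]; rewrite /l (cdotDl mOm s t Lu Lv (Lh i)).
  by ring.
have lK i u : test u -> l i u ^+ 2 <= K * cdot u u.
  move=> /tL[Lu _ _]; rewrite /l exprMn sd.
  apply: (@le_trans _ _ (d^-1 * (cdot u u * cdot (h i) (h i)))).
    by rewrite ler_pM2l ?invr_gt0// cdot_schwarz.
  rewrite mulrCA mulrC; apply: ler_wpM2r; first exact: cdot_ge0.
  rewrite /K (bigD1 i)//= lerDl; apply: sumr_ge0 => j _.
  by rewrite mulr_ge0 ?invr_ge0 ?cdot_ge0// ltW.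
have coer u : test u -> d^-1 * cdot u u <= grad u u + \sum_(i < n) l i u ^+ 2.
  move=> /Hh hu; rewrite -(ler_pM2l d0) mulrA mulfV ?gt_eqF// mul1r.
  apply: (le_trans hu); rewrite [leLHS]addrC [leRHS]mulrDr lerD2l mulr_sumr.
  apply: ler_sum => i _; rewrite /l exprMn sd mulrA mulfV ?gt_eqF//.
  by rewrite mul1r.
have below : grad phi phi < d^-1 * cdot phi phi.
  rewrite /d invf_div divfK ?gt_eqF//.
  by rewrite ltrDl.
have [m [v [mle Tv bv cv el]]] := minimizing_sequence
  (@test_function_lin R Om) (form_grad mOm H0 OmH) (form_dot mOm H0 OmH)
  l_lin lK coer Tphi b0 below.
have [u Lu vu] : exists2 g, cL2 g &
    forall k, cdot (lin 1 (-1) (v k) g) (lin 1 (-1) (v k) g) <= 8%:R ^- k.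
  by apply: cdot_cauchy => [k|k j kj]; [case: (tL _ (Tv k))|case: (cv k j kj)].
have gradE k j : grad (lin 1 (-1) (v k) (v j)) (lin 1 (-1) (v k) (v j)) =
    cdot (lin 1 (-1) (dx (v k)) (dx (v j))) (lin 1 (-1) (dx (v k)) (dx (v j))) +
    cdot (lin 1 (-1) (dy (v k)) (dy (v j))) (lin 1 (-1) (dy (v k)) (dy (v j))).
  have [sk _ _ _] := Tv k; have [sj _ _ _] := Tv j.
  by rewrite /grad dx_lin// dy_lin.
have [g1' Lg1 vg1] : exists2 g, cL2 g &
    forall k, cdot (lin 1 (-1) (dx (v k)) g) (lin 1 (-1) (dx (v k)) g) <= 8%:R ^- k.
  apply: cdot_cauchy => [k|k j kj]; first by case: (tL _ (Tv k)).
  have [_] := cv k j kj; rewrite gradE; apply: le_trans.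
  by rewrite lerDl cdot_ge0.
have [g2 Lg2 vg2] : exists2 g, cL2 g &
    forall k, cdot (lin 1 (-1) (dy (v k)) g) (lin 1 (-1) (dy (v k)) g) <= 8%:R ^- k.
  apply: cdot_cauchy => [k|k j kj]; first by case: (tL _ (Tv k)).
  have [_] := cv k j kj; rewrite gradE; apply: le_trans.
  by rewrite lerDr cdot_ge0.
have Lv k : cL2 (v k) by case: (tL _ (Tv k)).
have Lvx k : cL2 (dx (v k)) by case: (tL _ (Tv k)).
have Lvy k : cL2 (dy (v k)) by case: (tL _ (Tv k)).
apply: (@le_trans _ _ m%:E); last by rewrite lee_fin ler_pdivlMr.
apply: ereal_inf_lbound; exists m => //=.
exists (fun=> m), (fun=> u); split => // [i|c c0 i].
- exists g1', g2; split.
    split => //; exists v; split => //; exact: cvg_L2_geometric.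
  move=> psi Tpsi; have [Lp Lpx Lpy] := tL _ Tpsi.
  apply/eqP; rewrite -subr_eq0; apply/eqP.
  have -> : \int[leb2 R]_(p in C) (g1' p * dx psi p + g2 p * dy psi p) =
      cdot g1' (dx psi) + cdot g2 (dy psi).
    exact: (@RintegralD _ _ _ (mu2 R) C _ _ mC
      (@L2_mul_integrable _ _ _ (mu2 R) C mC _ _ Lg1 Lpx)
      (@L2_mul_integrable _ _ _ (mu2 R) C mC _ _ Lg2 Lpy)).
  have -> : \int[leb2 R]_(p in C) (u p * psi p) = cdot u psi by [].
  (* The residual of the weak equation does not depend on k, while its square is at most a fixed
     multiple of 8 ^- k. *)
  apply: (@sqr_eq0_of_geometric _ (4 * ((grad psi psi - m * cdot psi psi) +
     cdot (dx psi) (dx psi) + cdot (dy psi) (dy psi) + m ^+ 2 * cdot psi psi))) => k.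
  have h1 := el k _ Tpsi.
  have h2 := cdot_lim_le (Lvx k) Lg1 Lpx (vg1 k).
  have h3 := cdot_lim_le (Lvy k) Lg2 Lpy (vg2 k).
  have h4 := cdot_lim_le (Lv k) Lu Lp (vu k).
  exact: four_squares h1 h2 h3 h4.
(* Were u zero almost everywhere, the unit vector v 1 would lie at squared distance 1 from it,
   against the bound 1 / 8. *)
- apply/eqP; apply: contraT => ci.
  have u0 : {ae mu2 R, forall p, C p -> u p = 0}.
    apply: (@filterS _ _ (ae_filter_ringOfSetsType (mu2 R)) _ _ _ c0) => p h0 Cp.
    have := h0 Cp; rewrite big_ord1 => /eqP.
    have -> : (ord0 : 'I_1) = i by rewrite [i]ord1; exact: val_inj.
    by rewrite mulf_eq0 (negbTE ci)/= => /eqP.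
  have Lw := cL2_lin mOm 1 (-1) (Lv 1%N) Lu.
  have msq w : cL2 w -> measurable_fun (C : set (plane R)) (fun p => (w p ^+ 2)%:E).
    by move=> [mw _]; apply/measurable_EFinP; exact: measurable_funX.
  have e1 := @dotE _ _ _ (mu2 R) C _ Lw; have e2 := @dotE _ _ _ (mu2 R) C _ (Lv 1%N).
  have intE : (\int[mu2 R]_(p in C) ((lin 1 (-1) (v 1%N) u p) ^+ 2)%:E =
      \int[mu2 R]_(p in C) ((v 1%N p) ^+ 2)%:E)%E.
    apply: ge0_ae_eq_integral => //; [exact: msq|exact: msq| | |].
    - by move=> p _; rewrite lee_fin sqr_ge0.
    - by move=> p _; rewrite lee_fin sqr_ge0.
    - apply: (@filterS _ _ (ae_filter_ringOfSetsType (mu2 R)) _ _ _ u0) => p h0 Cp;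
      by rewrite /lin (h0 Cp) mul1r mulr0 addr0.
  have := vu 1%N; have : cdot (lin 1 (-1) (v 1%N) u) (lin 1 (-1) (v 1%N) u) = cdot (v 1%N) (v 1%N).
    by apply: EFin_inj; exact: etrans (esym e1) (etrans intE e2).
  rewrite bv => ->; rewrite expr1; lra.
Qed.

End eigenfunction.

(** * Smoothness of explicit functions, and rules of differentiation *)

Section smooth_algebra.
Context (R : realType).
Implicit Types (f g fx fy : R * R -> R).

Definition partials f fx fy :=
  [/\ continuous f,
      forall x y : R, is_derive x 1 (fun s => f (s, y)) (fx (x, y))
    & forall x y : R, is_derive y 1 (fun s => f (x, s)) (fy (x, y))].

Lemma partials_dxdy f fx fy : partials f fx fy ->
  [/\ forall p, derivable f p ((1 : R), (0 : R)),
      forall p, derivable f p ((0 : R), (1 : R)),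
      dx f = fx & dy f = fy].
Proof.
move=> [cf dxf dyf].
split.
- by move=> [x y]; rewrite /derivable quotient_x; case: (dxf x y).
- by move=> [x y]; rewrite /derivable quotient_y; case: (dyf x y).
- by apply/funext => -[x y]; rewrite /dx /derive quotient_x; case: (dxf x y).
- by apply/funext => -[x y]; rewrite /dy /derive quotient_y; case: (dyf x y).
Qed.

Variables (I : Type) (gen : I -> R * R -> R).

(* If the partial derivatives of the generators stay in the algebra, then all of
   its elements are smooth: no order of differentiation has to be tracked. *)
Inductive alg : (R * R -> R) -> Prop :=
| alg_gen i : alg (gen i)
| alg_cst c : alg (fun=> c)
| alg_add f g : alg f -> alg g -> alg (fun p => f p + g p)
| alg_mul f g : alg f -> alg g -> alg (fun p => f p * g p).

Hypothesis gen_partials : forall i, exists fx fy,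
  [/\ alg fx, alg fy & partials (gen i) fx fy].

Lemma alg_partials f : alg f -> exists fx fy, [/\ alg fx, alg fy & partials f fx fy].
Proof.
elim => [i|c|{}f g af [fx [fy [afx afy [cf f1 f2]]]] ag [gx [gy [agx agy [cg g1 g2]]]]
            |{}f g af [fx [fy [afx afy [cf f1 f2]]]] ag [gx [gy [agx agy [cg g1 g2]]]]].
- exact: gen_partials.
- exists (fun=> 0), (fun=> 0); split; [exact: alg_cst|exact: alg_cst|].
  split; [exact: cst_continuous| |] => x y; exact: is_derive_cst.
- exists (fun p => fx p + gx p), (fun p => fy p + gy p).
  split; [exact: alg_add|exact: alg_add|split].
  + by move=> p; apply: (@cvgD _ _ _ _ _ f g); [exact: cf|exact: cg].
  + by move=> x y; exact: is_deriveD.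
  + by move=> x y; exact: is_deriveD.
- exists (fun p => f p * gx p + g p * fx p), (fun p => f p * gy p + g p * fy p).
  split; [by apply: alg_add; exact: alg_mul|by apply: alg_add; exact: alg_mul|split].
  + by move=> p; apply: (@cvgM _ _ _ _ f g); [exact: cf|exact: cg].
  + move=> x y; exact: (@is_deriveM _ _ (fun s => f (s, y)) (fun s => g (s, y))).
  + move=> x y; exact: (@is_deriveM _ _ (fun s => f (x, s)) (fun s => g (x, s))).
Qed.

Lemma alg_smooth f : alg f -> smooth f.
Proof.
move=> af k; elim: k f af => [|k IH] f af /=.
  by have [fx [fy [_ _ [cf _ _]]]] := alg_partials af.
have [fx [fy [afx afy pf]]] := alg_partials af.
have [d1 d2 -> ->] := partials_dxdy pf; case: pf => cf _ _.
by split; [exact: cf|split; [exact: d1|exact: d2|exact: IH|exact: IH]].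
Qed.

End smooth_algebra.

Section derivative_rules.
Context (R : realType).
Implicit Types (f g : R -> R) (x df dg : R).

Lemma is_derive1M f g x df dg : is_derive x 1 f df -> is_derive x 1 g dg ->
  is_derive x 1 (fun t : R => f t * g t) (df * g x + f x * dg).
Proof.
move=> hf hg.
have h : is_derive x 1 (fun t : R => f t * g t) (f x *: dg + g x *: df) :=
  is_deriveM hf hg.
by apply: is_derive_eq h _; rewrite addrC /GRing.scale/= mulrC.
Qed.

Lemma is_derive1Ml (k : R) f x df : is_derive x 1 f df ->
  is_derive x 1 (fun t : R => k * f t) (k * df).
Proof.
move=> hf; have h := is_derive1M (is_derive_cst k x 1) hf.
by apply: is_derive_eq h _; rewrite mul0r add0r.
Qed.

Lemma is_derive1V f x df : f x != 0 -> is_derive x 1 f df ->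
  is_derive x 1 (fun t : R => (f t)^-1) (- df * (f x)^-1 ^+ 2).
Proof.
move=> f0 hf; have h := is_deriveV f0 hf.
by apply: is_derive_eq h _; rewrite /GRing.scale/= mulrC exprVn mulNr mulrN.
Qed.

Lemma is_derive1X f n x df : is_derive x 1 f df ->
  is_derive x 1 (fun t : R => f t ^+ n) (n%:R * f x ^+ n.-1 * df).
Proof.
move=> hf.
have -> : (fun t : R => f t ^+ n) = f ^+ n.
  by elim: n => [|n IH]; [rewrite expr0|rewrite exprS -IH]; apply/funext => t;
    rewrite ?exprS.
exact: is_deriveX.
Qed.

End derivative_rules.

(** * The smooth cut-off and the trial function *)

Section flat_functions.
Context (R : realType) (eps : R).
Hypothesis eps0 : 0 < eps.

(* The derivatives of exp (- eps / s), extended by 0 to s <= 0, are combinations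
   of these functions. *)
Definition flat (n : nat) (s : R) : R :=
  if 0 < s then s ^- n * expR (- eps / s) else 0.

(* The bound comes from [1 + t <= exp t] raised to the power n + 2. *)
Lemma flat_le n : exists2 K : R, 0 <= K & forall s, `|flat n s| <= K * s ^+ 2.
Proof.
exists ((n.+2%:R / eps) ^+ n.+2).
  by rewrite exprn_ge0// divr_ge0// ltW.
move=> s; rewrite /flat; case: ifPn => [s0|_]; last first.
  by rewrite normr0 mulr_ge0 ?sqr_ge0// exprn_ge0// divr_ge0// ltW.
rewrite ger0_norm; last by rewrite mulr_ge0 ?expR_ge0// invr_ge0 exprn_ge0// ltW.
have n0 : 0 < n.+2%:R :> R by [].
pose t := eps / s / n.+2%:R.
have t0 : 0 < t by rewrite !divr_gt0.
have -> : - eps / s = - (n.+2%:R * t).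
  by rewrite [_ * t]mulrC divfK ?gt_eqF// mulNr.
rewrite expRN expRM_natl.
have h : t ^+ n.+2 <= expR t ^+ n.+2.
  by rewrite lerXn2r ?nnegrE ?expR_ge0 ?(ltW t0)// (le_trans _ (expR_ge1Dx _))// lerDr.
have h2 : (expR t ^+ n.+2)^-1 <= t ^- n.+2.
  by rewrite lef_pV2 ?posrE ?exprn_gt0// expR_gt0.
apply: (@le_trans _ _ (s ^- n * t ^- n.+2)).
  by rewrite ler_wpM2l// invr_ge0 exprn_ge0// ltW.
rewrite le_eqVlt; apply/orP; left; apply/eqP.
have sn0 : s != 0 by rewrite gt_eqF.
have en0 : eps != 0 by rewrite gt_eqF.
have -> : t = (n.+2%:R / eps)^-1 * s^-1 by rewrite /t invf_div mulrAC.
rewrite exprMn invfM -!exprVn !invrK mulrCA; congr (_ * _).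
by rewrite exprVn -addn2 exprD mulKf// expf_neq0.
Qed.

Lemma flat0 n : flat n 0 = 0. Proof. by rewrite /flat ltxx. Qed.

(** Away from 0 this is a computation; at 0 the quadratic bound of [flat_le] sends the difference
    quotient to 0. *)
Lemma is_derive_flat n (s : R) :
  is_derive s 1 (flat n) (- n%:R * flat n.+1 s + eps * flat n.+2 s).
Proof.
have [s0|s0|->] := ltgtP s 0.
- rewrite /flat ltNge (ltW s0)/= !mulr0 addr0.
  apply: (@near_eq_is_derive _ _ _ (cst 0)) => //.
  near=> t; rewrite [0 < t]ltNge ltW//=; near: t; exact: lt_nbhsl.
- have fE k : flat k s = s ^- k * expR (- eps / s) by rewrite /flat s0.
  rewrite !fE.
  have sn0 : s != 0 by rewrite gt_eqF.
  apply: (@near_eq_is_derive R R R (fun t : R => t^-1 ^+ n * expR (- eps * t^-1)) (flat n) s 1).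
    near=> t; rewrite /flat ifT ?exprVn//; near: t; exact: lt_nbhsr.
  have dV := is_derive1V sn0 (is_derive_id s 1).
  have dVn := is_derive1X n dV.
  have dE := @is_derive1_comp R expR (fun t : R => - eps * t^-1) s _ _
    (is_derive_expR (- eps * s^-1)) (is_derive1Ml (- eps) dV).
  apply: is_derive_eq (is_derive1M dVn dE) _.
  case: n {dVn} => [|n].
    by rewrite -!exprVn /= !(mul0r, mulr0) oppr0 !mul0r !add0r; ring.
  by rewrite /= -!exprVn !exprS; ring.
- rewrite !flat0 !mulr0 addr0.
  have [K K0 hK] := flat_le n.
  have cv : (fun h : R => h^-1 *: (flat n (h *: (1 : R) + 0) - flat n 0)) @ 0^' --> (0 : R).
    apply/cvgr0Pnorm_le => e e0; near=> h.
    have h0 : h != 0 by near: h; exact: nbhs_dnbhs_neq.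
    rewrite flat0 subr0 addr0 scaler1 normrZ normfV.
    rewrite ler_pdivrMl ?normr_gt0//; apply: le_trans (hK h) _.
    rewrite -real_normK ?num_real// expr2 mulrA mulrC ler_pM2l ?normr_gt0//.
    have : `|h| <= e / (K + 1).
      near: h; apply: dnbhs0_le; by rewrite divr_gt0// ltr_wpDl.
    rewrite ler_pdivlMr ?ltr_wpDl// => hh; apply: le_trans hh.
    by rewrite mulrC ler_wpM2l// lerDl.
  split; first by apply/cvg_ex; exists 0.
  exact/cvg_lim.
Unshelve. all: by end_near. Qed.
End flat_functions.

Section trial_smooth.
Context (R : realType) (kap eps rho2 : R).
Hypotheses (kap0 : 0 < kap) (kap1 : kap < 1) (eps0 : 0 < eps).
Hypothesis rho2_gt : pi ^+ 2 < rho2.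
Implicit Types x y : R.

(* A smooth 2 pi-periodic approximation of the function |x| of [-pi, pi]. *)
Definition sabs x : R := acos (cos kap * cos x).

Lemma cos_kap : 0 < cos kap < 1.
Proof.
have p2 := pi_ge2 R.
apply/andP; split.
  by apply: cos_gt0_pihalf; apply/andP; have := kap0; have := kap1; split; lra.
rewrite -cos0 ltr_cos ?in_itv/= ?lexx ?pi_ge0//.
by rewrite (ltW kap0)/= (le_trans (ltW kap1))//; lra.
Qed.

Lemma kcos_itv x : -1 < cos kap * cos x < 1.
Proof.
have /andP[k0 k1] := cos_kap.
rewrite -ltr_norml normrM (gtr0_norm k0).
by apply: le_lt_trans k1; rewrite ger_pMr// cos_max.
Qed.

Let kcosW x : -1 <= cos kap * cos x <= 1.
Proof. by have /andP[/ltW -> /ltW ->] := kcos_itv x. Qed.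

Lemma cos_sabs x : cos (sabs x) = cos kap * cos x.
Proof. by rewrite /sabs acosK// in_itv/= kcosW. Qed.

Lemma sabs_gt0 x : 0 < sabs x.
Proof. by apply: acos_gt0; have /andP[/ltW -> ->] := kcos_itv x. Qed.

Lemma sabs_ltpi x : sabs x < pi.
Proof. by apply: acos_ltpi; have /andP[-> /ltW ->] := kcos_itv x. Qed.

Lemma sin_sabs_gt0 x : 0 < sin (sabs x).
Proof. by apply: sin_gt0_pi; rewrite sabs_gt0 sabs_ltpi. Qed.

Definition dsabs x : R := cos kap * sin x * (sin (sabs x))^-1.

Lemma is_derive_sabs x : is_derive x 1 sabs (dsabs x).
Proof.
have h := @is_derive1_comp R acos (fun t => cos kap * cos t) x _ _
  (is_derive1_acos (kcos_itv x)) (is_derive1Ml (cos kap) (is_derive_cos x)).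
apply: is_derive_eq h _.
by rewrite -sin_acos// -/(sabs x) /dsabs; ring.
Qed.

(** As sin (sabs x) ^ 2 = 1 - cos kap ^ 2 cos x ^ 2, clearing the denominator reduces the claim to
    cos kap ^ 2 <= 1. *)
Lemma dsabs_sqr_le1 x : dsabs x ^+ 2 <= 1.
Proof.
have /andP[k0 k1] := cos_kap.
have s0 := sin_sabs_gt0 x.
rewrite /dsabs exprMn exprVn ler_pdivrMr ?exprn_gt0// mul1r sin2cos2 cos_sabs.
by rewrite !exprMn sin2cos2; have := sqr_ge0 (cos x); nra.
Qed.

Lemma sabs_periodic x : sabs (x + 2 * pi) = sabs x.
Proof. by rewrite /sabs mulr_natl cosD2pi. Qed.

(** The cosine decreases on [0, pi], and cos (|x| - kap), cos (|x| + kap) lie above and below cos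
    kap cos x by the nonnegative amount sin kap sin |x|. *)
Lemma sabs_near x : - pi <= x <= pi -> `|x| - kap <= sabs x <= `|x| + kap.
Proof.
rewrite -ler_norml => xpi; rewrite /sabs -(cos_norm x) -/(sabs `|x|).
move: (normr_ge0 x) xpi; move: `|x| => {}x x0 xpi.
have sx : 0 <= sin x by apply: sin_ge0_pi; rewrite x0.
have sk : 0 <= sin kap.
  by apply: sin_ge0_pi; have := pi_ge2 R; have := kap0; have := kap1 => *; apply/andP; split; lra.
have [g0 gp] := (sabs_gt0 x, sabs_ltpi x).
have k0 := kap0.
apply/andP; split.
  have [xk|xk] := leP (x - kap) 0; first by apply: le_trans xk (ltW g0).
  rewrite leNgt -ltr_cos ?in_itv/=; last 2 first.
  - by rewrite !ltW.
  - by rewrite (ltW xk)/=; lra.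
  by rewrite -leNgt cos_sabs cosB; nra.
have [xk|xk] := leP (x + kap) pi; last by apply: ltW; lra.
rewrite leNgt -ltr_cos ?in_itv/=; last 2 first.
- by rewrite xk andbT; lra.
- by rewrite !ltW.
by rewrite -leNgt cos_sabs cosD; nra.
Qed.

Lemma sabs2_lt x : sabs x ^+ 2 < rho2.
Proof.
apply: lt_trans rho2_gt; have := sabs_gt0 x; have := sabs_ltpi x.
by move: (sabs x) (pi : R) => s p; nra.
Qed.

(* 1 / l(x)^2 for the half height l; the parameter rho2 is slightly smaller
   than r^2 to keep the support inside the open disk. *)
Definition ilen2 x : R := (rho2 - sabs x ^+ 2)^-1.

Lemma ilen2_gt0 x : 0 < ilen2 x.
Proof. by rewrite invr_gt0 subr_gt0 sabs2_lt. Qed.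

Definition dilen2 x : R := 2 * sabs x * dsabs x * (ilen2 x * ilen2 x).

Lemma is_derive_ilen2 x : is_derive x 1 ilen2 (dilen2 x).
Proof.
have h1 := is_derive1X 2 (is_derive_sabs x).
have h2 : is_derive x 1 (fun t => rho2 - sabs t ^+ 2) (0 - 2 * sabs x ^+ 2.-1 * dsabs x).
  exact: is_deriveB.
have n0 : rho2 - sabs x ^+ 2 != 0 by rewrite subr_eq0 gt_eqF// sabs2_lt.
have h3 : is_derive x 1 ilen2 (- (0 - 2 * sabs x ^+ 2.-1 * dsabs x) * ilen2 x ^+ 2).
  exact: (@is_derive1V R (fun t => rho2 - sabs t ^+ 2) x _ n0 h2).
apply: is_derive_eq h3 _.
by rewrite /dilen2 -/(ilen2 x) /= expr1; ring.
Qed.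

Lemma ilen2_periodic x : ilen2 (x + 2 * pi) = ilen2 x.
Proof. by rewrite /ilen2 sabs_periodic. Qed.

(* s = 1 - t^2 at t = y / l(x). *)
Definition targ (p : R * R) : R := 1 - p.2 * p.2 * ilen2 p.1.

(** The polynomial profile alone, extended by 0 to s <= 0, would have a corner at s = 0. *)
Definition profile (s : R) : R := (3 * s + 2 * (s * s)) * flat eps 0 s.

Definition trial (p : R * R) : R := profile (targ p).

Definition dprofile (s : R) : R :=
  (3 + 4 * s) * flat eps 0 s + (3 * s + 2 * (s * s)) * (eps * flat eps 2 s).

Lemma is_derive_profile (s : R) : is_derive s 1 profile (dprofile s).
Proof.
have hid := is_derive_id s (1 : R).
have h1 := is_derive1Ml 3 hid.
have h2 := is_derive1Ml 2 (is_derive1M hid hid).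
have h3 : is_derive s 1 (fun t => 3 * t + 2 * (t * t)) (3 * 1 + 2 * (1 * s + s * 1)).
  exact: is_deriveD.
have h4 : is_derive s 1 profile _ := is_derive1M h3 (is_derive_flat eps0 0 s).
by apply: is_derive_eq h4 _; rewrite /dprofile; ring.
Qed.

Lemma is_derive_continuous (f : R -> R) (df : R -> R) :
  (forall x, is_derive x 1 f (df x)) -> continuous f.
Proof.
move=> h x; apply: differentiable_continuous; apply/derivable1_diffP.
by case: (h x).
Qed.

Lemma partials_fst (f df : R -> R) : (forall x, is_derive x 1 f (df x)) ->
  partials (fun p => f p.1) (fun p => df p.1) (fun=> 0).
Proof.
move=> h; split.
- move=> p; apply: (@continuous_comp _ _ _ fst f); first exact: cvg_fst.
  exact: is_derive_continuous h _.
- by move=> x y; exact: h.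
- by move=> x y; exact: (is_derive_cst (f x) y 1).
Qed.

Lemma continuous_targ : continuous targ.
Proof.
have [cQ _ _] := partials_fst is_derive_ilen2.
have cyy : continuous (fun p : R * R => p.2 * p.2).
  by move=> p; apply: (@cvgM _ _ _ _ snd snd); exact: cvg_snd.
have cyQ : continuous (fun p : R * R => p.2 * p.2 * ilen2 p.1).
  by move=> p; apply: cvgM; [exact: cyy|exact: cQ].
by move=> p; apply: cvgB; [exact: cvg_cst|exact: cyQ].
Qed.

Lemma is_derive_targx x y :
  is_derive x 1 (fun s => targ (s, y)) (- (y * y * dilen2 x)).
Proof.
have h := is_derive1Ml (y * y) (is_derive_ilen2 x).
have : is_derive x 1 (fun s => 1 - y * y * ilen2 s) (0 - y * y * dilen2 x) by exact: is_deriveB.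
by rewrite sub0r.
Qed.

Lemma is_derive_targy x y :
  is_derive y 1 (fun s => targ (x, s)) (- (2 * y * ilen2 x)).
Proof.
have hid := is_derive_id y (1 : R).
have h := is_derive1Ml (ilen2 x) (is_derive1M hid hid).
have h2 : is_derive y 1 (fun s => 1 - ilen2 x * (s * s)) (0 - ilen2 x * (1 * y + y * 1)).
  exact: is_deriveB.
have -> : (fun s => targ (x, s)) = (fun s => 1 - ilen2 x * (s * s)).
  by apply/funext => s; rewrite /targ/= mulrC.
by apply: is_derive_eq h2 _; ring.
Qed.

Lemma trial_partials : partials trial
  (fun p => dprofile (targ p) * - (p.2 * p.2 * dilen2 p.1))
  (fun p => dprofile (targ p) * - (2 * p.2 * ilen2 p.1)).
Proof.
split.
- move=> p; apply: (@continuous_comp _ _ _ targ profile); first exact: continuous_targ.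
  exact: is_derive_continuous is_derive_profile _.
- move=> x y; exact: (@is_derive1_comp R profile (fun s => targ (s, y)) x _ _
    (is_derive_profile (targ (x, y))) (is_derive_targx x y)).
- move=> x y; exact: (@is_derive1_comp R profile (fun s => targ (x, s)) y _ _
    (is_derive_profile (targ (x, y))) (is_derive_targy x y)).
Qed.

(** Differentiating [sabs] brings in 1 / sin (sabs x), hence [gen_w], whose own derivative stays in
    the algebra. All orders of [gen_flat] are present because each derivative raises the order by up
    to 2. *)
Inductive generator := gen_y | gen_sin | gen_cos | gen_sabs | gen_w | gen_ilen2
  | gen_flat of nat.

Definition gen (i : generator) (p : R * R) : R :=
  match i with
  | gen_y => p.2
  | gen_sin => sin p.1
  | gen_cos => cos p.1
  | gen_sabs => sabs p.1
  | gen_w => (sin (sabs p.1))^-1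
  | gen_ilen2 => ilen2 p.1
  | gen_flat n => flat eps n (targ p)
  end.

Local Notation alg := (alg gen).

Lemma alg_dsabs : alg (fun p => dsabs p.1).
Proof.
apply: alg_mul; last exact: (alg_gen _ gen_w).
by apply: alg_mul; [exact: alg_cst|exact: (alg_gen _ gen_sin)].
Qed.

Lemma alg_ilen2 : alg (fun p => ilen2 p.1).
Proof. exact: (alg_gen _ gen_ilen2). Qed.

Lemma alg_y : alg (fun p => p.2).
Proof. exact: (alg_gen _ gen_y). Qed.

Lemma alg_flat n : alg (fun p => flat eps n (targ p)).
Proof. exact: (alg_gen _ (gen_flat n)). Qed.

Lemma alg_dilen2 : alg (fun p => dilen2 p.1).
Proof.
apply: alg_mul; last by apply: alg_mul; exact: alg_ilen2.
apply: alg_mul; last exact: alg_dsabs.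
by apply: alg_mul; [exact: alg_cst|exact: (alg_gen _ gen_sabs)].
Qed.

Lemma alg_opp f : alg f -> alg (fun p => - f p).
Proof.
move=> af; have -> : (fun p => - f p) = (fun p => -1 * f p).
  by apply/funext => p; rewrite mulN1r.
by apply: alg_mul => //; exact: alg_cst.
Qed.

Lemma gen_partials i : exists fx fy, [/\ alg fx, alg fy & partials (gen i) fx fy].
Proof.
have a0 : alg (fun=> 0) by exact: alg_cst.
case: i => [||||||n].
- exists (fun=> 0), (fun=> 1); split; [exact: alg_cst|exact: alg_cst|split].
  + by move=> p; exact: cvg_snd.
  + by move=> x y; exact: (is_derive_cst y x 1).
  + by move=> x y; exact: is_derive_id.
- exists (fun p => cos p.1), (fun=> 0); split => //.
    exact: (alg_gen _ gen_cos).
  exact: partials_fst (@is_derive_sin R).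
- exists (fun p => - sin p.1), (fun=> 0); split => //.
    by apply: alg_opp; exact: (alg_gen _ gen_sin).
  exact: (partials_fst (@is_derive_cos R)).
- exists (fun p => dsabs p.1), (fun=> 0); split => //; first exact: alg_dsabs.
  exact: (partials_fst is_derive_sabs).
- exists (fun p => - (cos kap * cos p.1 * dsabs p.1) *
      ((sin (sabs p.1))^-1 * (sin (sabs p.1))^-1)), (fun=> 0); split => //.
    apply: alg_mul; last by apply: alg_mul; exact: (alg_gen _ gen_w).
    apply: alg_opp; apply: alg_mul; last exact: alg_dsabs.
    by apply: alg_mul; [exact: alg_cst|exact: (alg_gen _ gen_cos)].
  apply: (@partials_fst (fun x => (sin (sabs x))^-1)
    (fun x => - (cos kap * cos x * dsabs x) * ((sin (sabs x))^-1 * (sin (sabs x))^-1))) => x.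
  have h := @is_derive1_comp R sin sabs x _ _ (is_derive_sin (sabs x)) (is_derive_sabs x).
  rewrite cos_sabs in h; rewrite -expr2.
  by apply: (is_derive1V _ h); rewrite gt_eqF// sin_sabs_gt0.
- exists (fun p => dilen2 p.1), (fun=> 0); split => //; first exact: alg_dilen2.
  exact: (partials_fst is_derive_ilen2).
- pose df p := - n%:R * flat eps n.+1 (targ p) + eps * flat eps n.+2 (targ p).
  have adf : alg df.
    by apply: alg_add; apply: alg_mul; by [exact: alg_cst|exact: alg_flat].
  exists (fun p => df p * - (p.2 * p.2 * dilen2 p.1)), (fun p => df p * - (2 * p.2 * ilen2 p.1)).
  split.
  + apply: alg_mul => //; apply: alg_opp; apply: alg_mul; last exact: alg_dilen2.
    by apply: alg_mul; exact: alg_y.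
  + apply: alg_mul => //; apply: alg_opp; apply: alg_mul; last exact: alg_ilen2.
    by apply: alg_mul; [exact: alg_cst|exact: alg_y].
  split.
  + move=> p; apply: (@continuous_comp _ _ _ targ (flat eps n)); first exact: continuous_targ.
    exact: is_derive_continuous (is_derive_flat eps0 n) _.
  + move=> x y; exact: (@is_derive1_comp R (flat eps n) (fun s => targ (s, y)) x _ _
      (is_derive_flat eps0 n (targ (x, y))) (is_derive_targx x y)).
  + move=> x y; exact: (@is_derive1_comp R (flat eps n) (fun s => targ (x, s)) y _ _
      (is_derive_flat eps0 n (targ (x, y))) (is_derive_targy x y)).
Qed.

Lemma trial_smooth : smooth trial.
Proof.
apply: (alg_smooth gen_partials).
have atarg : alg targ.
  apply: alg_add; first exact: alg_cst.
  apply: alg_opp; apply: alg_mul; last exact: alg_ilen2.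
  by apply: alg_mul; exact: alg_y.
apply: alg_mul; last exact: alg_flat.
apply: alg_add; apply: alg_mul; by [exact: alg_cst|exact: atarg|exact: alg_mul].
Qed.

End trial_smooth.

(** * The geodesic disk, and the trial function as a test function on it *)

Section disk.
Context (R : realType) (r : R).
Hypothesis r0 : 0 < r.
Local Notation Om := (geodesic_disk ((0 : R), (0 : R)) r).

Lemma geodesic_disk_lift (n : int) (x y : R) :
  (x + n%:~R * (2 * pi)) ^+ 2 + y ^+ 2 < r ^+ 2 -> Om (x, y).
Proof.
move=> h; rewrite /geodesic_disk /cyl_dist /=.
apply: (@le_lt_trans _ _ (Num.sqrt ((x + n%:~R * (2 * pi)) ^+ 2 + y ^+ 2))).
  apply: ge_inf; last by exists n => //=; rewrite !subr0.
  by exists 0 => _ [k _ <-]; exact: sqrtr_ge0.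
rewrite -[ltRHS](ger0_norm (ltW r0)) -sqrtr_sqr ltr_sqrt//.
by rewrite exprn_gt0.
Qed.

Lemma cell_diskE : cell Om = strip R `&` [set p | p.1 ^+ 2 + p.2 ^+ 2 < r ^+ 2].
Proof.
apply/seteqP; split => [[x y] [h1 h2]|[x y] [h1 h2]]; split => //.
  by apply/(geodesic_diskE y r0 h2).
by apply/(geodesic_diskE y r0 h1).
Qed.

Lemma measurable_cell_disk : measurable (cell Om).
Proof.
rewrite cell_diskE; apply: measurableI.
  rewrite (_ : strip R = fst @^-1` `[- pi, pi]%classic); last first.
    by apply/seteqP; split => p /=; rewrite in_itv.
  rewrite -[X in measurable X]setTI.
  by apply: measurable_fst => //; exact: measurable_itv.
apply: open_measurable_plane.
have cf : continuous (fun p : R * R => p.1 ^+ 2 + p.2 ^+ 2).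
  move=> p; apply: cvgD.
    by apply: (@continuous_sqr R (R * R)%type fst) => q; exact: cvg_fst.
  by apply: (@continuous_sqr R (R * R)%type snd) => q; exact: cvg_snd.
rewrite (_ : [set _ | _] = (fun p : R * R => p.1 ^+ 2 + p.2 ^+ 2) @^-1` `]-oo, r ^+ 2[%classic).
  by move/continuousP : cf; apply; exact: interval_open.
by apply/seteqP; split => p /=; rewrite in_itv.
Qed.

Lemma cell_disk_height p : cell Om p -> - r <= p.2 < r.
Proof.
rewrite cell_diskE => -[_ /=]; have := r0.
move: (p.1) (p.2) => x y r0' h; have := sqr_ge0 x => x2.
by apply/andP; split; nra.
Qed.

Lemma periodic_int (f : R -> R) (T : R) : (forall x, f (x + T) = f x) ->
  forall (n : int) x, f (x + n%:~R * T) = f x.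
Proof.
move=> fT n x.
have pos k y : f (y + k%:R * T) = f y.
  elim: k y => [|k IH] y; first by rewrite mul0r addr0.
  by rewrite -addn1 natrD mulrDl mul1r addrA fT.
case: n => k; first exact: pos.
rewrite NegzE mulrNz mulNr -[LHS](pos k.+1).
by rewrite subrK.
Qed.

Lemma lift_in_strip (x : R) : exists n : int, - pi <= x + n%:~R * (2 * pi) <= pi.
Proof.
have p0 := pi_gt0 R; have p2 : 0 < 2 * pi :> R by rewrite mulr_gt0.
exists (- Num.floor ((x + pi) / (2 * pi))).
have := floor_itv ((x + pi) / (2 * pi)).
move: (Num.floor _) => m /andP[h1 h2].
rewrite ler_pdivlMr// in h1; rewrite ltr_pdivrMr// intrD mulrDl mul1r in h2.
by rewrite mulrNz mulNr; apply/andP; split; lra.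
Qed.

Variables (kap eps rho2 : R).
Hypotheses (kap0 : 0 < kap) (kap1 : kap <= 1 / 2) (eps0 : 0 < eps).
Hypotheses (rho2E : rho2 = r ^+ 2 - 7 * kap) (rho2_gt : pi ^+ 2 < rho2).
Hypothesis pi_lt : pi <= 22 / 7 :> R.

Let kap1' : kap < 1. Proof. by apply: le_lt_trans kap1 _; lra. Qed.

Local Notation trial := (trial kap eps rho2).
Local Notation targ := (targ kap rho2).
Local Notation ilen2 := (ilen2 kap rho2).
Local Notation sabs := (sabs kap).

Lemma flat_le0 n s : s <= 0 -> flat eps n s = 0.
Proof. by move=> s0; rewrite /flat ltNge s0. Qed.

(** Passing from [sabs] x to the absolute value of the lift of x in [-pi, pi] increases the square
    by at most 2 pi kap + kap ^ 2 < 7 kap, the amount by which rho2 lies below r ^ 2. *)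
Lemma targ_ge0_Om p : 0 <= targ p -> Om p.
Proof.
case: p => x y; rewrite /targ/= subr_ge0 => h.
have ilen20 := ilen2_gt0 kap0 kap1' rho2_gt x.
have [n xn] := lift_in_strip x.
apply: (@geodesic_disk_lift n).
have E : sabs x = sabs (x + n%:~R * (2 * pi)).
  by rewrite (@periodic_int _ (2 * pi))// => z; exact: sabs_periodic.
have := sabs_near kap0 kap1' xn; rewrite -E => /andP[s1 _].
have s2 := sabs_ltpi kap0 kap1' x; have s3 := sabs_gt0 kap0 kap1' x.
have y2 : y ^+ 2 <= rho2 - sabs x ^+ 2.
  by move: h; rewrite /ilen2 -expr2 -ler_pdivlMr// ?invrK ?mul1r// div1r invrK.
rewrite rho2E in y2; move: (x + n%:~R * (2 * pi)) s1 => z s1.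
have z2 : z ^+ 2 <= (sabs x + kap) ^+ 2.
  rewrite -(real_normK (num_real z)) lerXn2r ?nnegrE//; last by lra.
  by rewrite addr_ge0// ltW.
have k0 := kap0; have k1 := kap1; have pl := pi_lt.
move: (sabs x) z2 y2 s2 s3 => s *; nra.
Qed.

Lemma trial_test : test_function Om trial.
Proof.
have cl : closure [set p | trial p != 0] `<=` [set p | 0 <= targ p].
  have clo : closed [set p | 0 <= targ p].
    rewrite (_ : [set _ | _] = targ @^-1` `[0, +oo[%classic); last first.
      by apply/seteqP; split => p /=; rewrite in_itv/= andbT.
    apply: closed_comp; last exact: interval_closed.
    by move=> p _; exact: (continuous_targ kap0 kap1' rho2_gt).
  rewrite (iffLR (closure_id _) clo); apply: closure_subset => p /=.
  apply: contraR; rewrite -ltNge => /ltW a0.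
  by rewrite /trial /profile (flat_le0 _ a0) mulr0.
split.
- exact: (trial_smooth kap0 kap1' eps0 rho2_gt).
- by move=> x y; rewrite /trial /targ/= ilen2_periodic.
- by move=> p /cl; exact: targ_ge0_Om.
- have cK : compact (`[- pi, pi]%classic `*` `[- r, r]%classic : set (R * R)).
    by apply: compact_setX; exact: segment_compact.
  apply: (subclosed_compact _ cK).
    apply: closedI; first exact: closed_closure.
    have -> : strip R = fst @^-1` `[- pi, pi]%classic.
      by apply/seteqP; split => p /=; rewrite in_itv.
    apply: closed_comp; last exact: interval_closed.
    by move=> p _; exact: cvg_fst.
  move=> p [/cl/targ_ge0_Om Op sp].
  have /cell_disk_height/andP[h1 /ltW h2] : cell Om p by split.
  by split; rewrite /= in_itv//= h1.
Qed.

End disk.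

(** * Integrals of the trial function along vertical lines *)

Section profile_bounds.
Context (R : realType) (eps : R).
Hypothesis eps0 : 0 < eps.

Lemma flat0_itv (s : R) : 0 < s -> 0 <= flat eps 0 s <= 1 /\ s - eps <= s * flat eps 0 s.
Proof.
move=> s0; rewrite /flat s0 expr0 invr1 mul1r; split.
  by rewrite expR_ge0/= -expR0 ler_expR mulNr oppr_le0 divr_ge0// ltW.
have h := expR_ge1Dx (- eps / s).
have := ler_wpM2l (ltW s0) h; apply: le_trans.
by rewrite mulrDr mulr1 mulrCA mulfV ?gt_eqF// mulr1.
Qed.

(** Let f = exp (- eps / s) >= 1 - eps / s. Then (s f) ^ 2 >= s ^ 2 - 2 eps s, and the other factor
    satisfies (3 + 2 s) ^ 2 s <= 25 on [0, 1]. *)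
Lemma profile_sqr_ge (s : R) : 0 <= s <= 1 ->
  (3 * s + 2 * (s * s)) ^+ 2 - 50 * eps <= profile eps s ^+ 2.
Proof.
move=> /andP[]; have e0 := eps0; rewrite le_eqVlt => /predU1P[<- _|s0 s1].
  by rewrite !(mulr0, addr0) expr0n/= sub0r (le_trans _ (sqr_ge0 _))//; lra.
have [/andP[f0 f1] sf] := flat0_itv s0; rewrite /profile.
move: (flat eps 0 s) f0 f1 sf => f f0 f1 sf.
have h : s ^+ 2 - 2 * eps * s <= (s * f) ^+ 2.
  have sf0 : 0 <= s * f by rewrite mulr_ge0// ltW.
  have [se|se] := leP eps s; last by apply: le_trans (sqr_ge0 _); nra.
  have : (s - eps) ^+ 2 <= (s * f) ^+ 2 by rewrite lerXn2r ?nnegrE ?subr_ge0.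
  nra.
have -> : ((3 * s + 2 * (s * s)) * f) ^+ 2 = (3 + 2 * s) ^+ 2 * (s * f) ^+ 2 by ring.
have -> : (3 * s + 2 * (s * s)) ^+ 2 = (3 + 2 * s) ^+ 2 * s ^+ 2 by ring.
have h2 := ler_wpM2l (sqr_ge0 (3 + 2 * s)) h.
have h3 : (3 + 2 * s) ^+ 2 * s <= 25.
  have : (3 + 2 * s) ^+ 2 <= 25 by nra.
  have := sqr_ge0 (3 + 2 * s); move: (_ ^+ 2) => w; nra.
have h4 := ler_wpM2l (ltW e0) h3.
by lra.
Qed.

(* As (1 + t) exp (- t) <= 1, the cut-off does not increase the derivative. *)
Lemma dprofile_bound (s : R) : dprofile eps s ^+ 2 <= (if 0 < s then (3 + 4 * s) ^+ 2 else 0).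
Proof.
have e0 := eps0.
case: ifPn => [s0|]; last first.
  by rewrite -leNgt => s0; rewrite /dprofile !flat_le0// !mulr0 addr0 expr0n.
have sn0 : s != 0 by rewrite gt_eqF.
have -> : dprofile eps s = ((3 + 4 * s) + (3 + 2 * s) * (eps / s)) * flat eps 0 s.
  by rewrite /dprofile /flat s0 expr0 invr1 mul1r; field.
have t0 : 0 < eps / s by rewrite divr_gt0.
have ft : flat eps 0 s * (1 + eps / s) <= 1.
  rewrite /flat s0 expr0 invr1 mul1r mulNr expRN mulrC ler_pdivrMr ?expR_gt0//.
  by rewrite mul1r expR_ge1Dx.
have [/andP[f0 f1] _] := flat0_itv s0.
move: (flat eps 0 s) (eps / s) f0 f1 t0 ft => f t f0 f1 t0 ft.
have h0 : 0 <= (3 + 4 * s + (3 + 2 * s) * t) * f.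
  by rewrite mulr_ge0// addr_ge0 ?mulr_ge0//; lra.
have h1 : (3 + 4 * s + (3 + 2 * s) * t) * f <= 3 + 4 * s.
  have h2 : 0 <= f * t * (2 * s) by rewrite !mulr_ge0//; lra.
  have h3 : 0 <= 3 + 4 * s by lra.
  have := ler_wpM2l h3 ft; nra.
by rewrite lerXn2r// nnegrE; lra.
Qed.

End profile_bounds.

Section even_polynomials.
Context (R : realType).
Local Notation lam := (@lebesgue_measure R).

(** Without the cut-off, the squares of the trial function and of its partial derivatives are even
    polynomials in y of degree at most 8. *)
Definition evenpoly (a0 a1 a2 a3 a4 : R) (y : R) : R :=
  a0 + a1 * y ^+ 2 + a2 * y ^+ 4 + a3 * y ^+ 6 + a4 * y ^+ 8.

Lemma is_derive_monomial (a : R) n (y : R) :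
  is_derive y 1 (fun t => a / n.+1%:R * t ^+ n.+1) (a * y ^+ n).
Proof.
apply: is_derive_eq (is_derive1Ml _ (is_derive1X n.+1 (is_derive_id y 1))) _.
by rewrite /= mulr1 mulrA divfK// pnatr_eq0.
Qed.

Lemma continuous_evenpoly a0 a1 a2 a3 a4 : continuous (evenpoly a0 a1 a2 a3 a4).
Proof.
have cm a n : continuous (fun y : R => a * y ^+ n).
  by move=> y; apply: cvgM; [exact: cvg_cst|exact: exprn_continuous].
move=> y; apply: cvgD; last exact: cm.
apply: cvgD; last exact: cm.
apply: cvgD; last exact: cm.
by apply: cvgD; [exact: cvg_cst|exact: cm].
Qed.

Lemma integral_evenpoly a0 a1 a2 a3 a4 (L : R) : 0 < L ->
  \int[lam]_(y in `[- L, L]) evenpoly a0 a1 a2 a3 a4 y =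
  2 * (a0 * L + a1 / 3 * L ^+ 3 + a2 / 5 * L ^+ 5 + a3 / 7 * L ^+ 7 + a4 / 9 * L ^+ 9).
Proof.
move=> L0; pose F (y : R) := a0 / 1%:R * y ^+ 1 + a1 / 3%:R * y ^+ 3 + a2 / 5%:R * y ^+ 5 +
  a3 / 7%:R * y ^+ 7 + a4 / 9%:R * y ^+ 9.
have dF (y : R) : is_derive y 1 F (evenpoly a0 a1 a2 a3 a4 y).
  have h := is_deriveD (is_deriveD (is_deriveD (is_deriveD (is_derive_monomial a0 0 y)
    (is_derive_monomial a1 2 y)) (is_derive_monomial a2 4 y)) (is_derive_monomial a3 6 y))
    (is_derive_monomial a4 8 y).
  have h2 : is_derive y 1 F _ := h.
  by apply: is_derive_eq h2 _; rewrite /evenpoly expr0 mulr1.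
have cF := is_derive_continuous dF.
rewrite /Rintegral (@continuous_FTC2 _ _ F).
- by rewrite /= /F; field.
- by rewrite -subr_gt0 opprK addr_gt0.
- exact/continuous_subspaceT/continuous_evenpoly.
- split.
  + by move=> x _; case: (dF x).
  + exact/cvg_at_right_filter/cF.
  + exact/cvg_at_left_filter/cF.
- by move=> x _; rewrite derive1E; exact: derive_val.
Qed.

End even_polynomials.

Section one_dimensional.
Context (R : realType).
Local Notation lam := (@lebesgue_measure R).
Implicit Types (f g : R -> R) (L r : R).

Lemma continuous_itv_integrable f (a b : R) : continuous f ->
  lam.-integrable (`[a, b]%classic : set (measurableTypeR R)) (EFin \o f).
Proof.
move=> cf; apply: continuous_compact_integrable; first exact: segment_compact.
exact: continuous_subspaceT.
Qed.

Lemma sub_itv L r : L < r -> `[- L, L]%classic `<=` (`[- r, r[%classic : set R).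
Proof. by move=> Lr y /=; rewrite !in_itv/= => /andP[h1 h2]; apply/andP; split; lra. Qed.

Lemma Rintegral_le_core f g L r : L < r -> continuous f -> continuous g ->
  (forall y, ~~ (- L <= y <= L) -> f y = 0) ->
  (forall y, - L <= y <= L -> f y <= g y) ->
  \int[lam]_(y in `[- r, r[) f y <= \int[lam]_(y in `[- L, L]) g y.
Proof.
move=> Lr cf cg f0 fg.
have -> : \int[lam]_(y in `[- r, r[) f y = \int[lam]_(y in `[- L, L]) f y.
  rewrite Rintegral_mkcond [RHS]Rintegral_mkcond; apply: eq_Rintegral => y _.
  rewrite !patchE; have [yL|yL] := boolP (y \in `[- L, L]%classic).
    by rewrite ifT//; apply/mem_set/(sub_itv Lr)/set_mem.
  by case: ifPn => // _; apply: f0; move: yL; rewrite mem_setE in_itv.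
apply: le_Rintegral; [exact: measurable_itv| | |].
- exact: continuous_itv_integrable.
- exact: continuous_itv_integrable.
- by move=> y; rewrite /= in_itv; exact: fg.
Qed.

Lemma Rintegral_ge_core f g L r : L < r -> continuous f -> continuous g ->
  (forall y, 0 <= f y) ->
  (forall y, - L <= y <= L -> g y <= f y) ->
  \int[lam]_(y in `[- L, L]) g y <= \int[lam]_(y in `[- r, r[) f y.
Proof.
move=> Lr cf cg f0 gf.
apply: (@le_trans _ _ (\int[lam]_(y in `[- L, L]) f y)).
  apply: le_Rintegral; [exact: measurable_itv| | |].
  - exact: continuous_itv_integrable.
  - exact: continuous_itv_integrable.
  - by move=> y; rewrite /= in_itv; exact: gf.
apply: Rintegral_subset_le; last by move=> y _.
- exact: measurable_itv.
- exact: measurable_itv.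
- exact: sub_itv.
- exact: itv_co_integrable.
Qed.

End one_dimensional.

Section trial_integrals.
Context (R : realType) (r kap eps rho2 : R).
Hypotheses (r0 : 0 < r) (kap0 : 0 < kap) (kap1 : kap < 1) (eps0 : 0 < eps).
Hypotheses (rho2_r : rho2 < r ^+ 2) (rho2_gt : pi ^+ 2 < rho2).
Local Notation lam := (@lebesgue_measure R).
Local Notation trial := (trial kap eps rho2).
Local Notation targ := (targ kap rho2).
Local Notation ilen2 := (ilen2 kap rho2).
Local Notation dilen2 := (dilen2 kap rho2).
Local Notation sabs := (sabs kap).
Local Notation dsabs := (dsabs kap).

Definition len (x : R) := Num.sqrt (rho2 - sabs x ^+ 2).
Local Notation L := len.

Lemma len_gt0 x : 0 < L x.
Proof. by rewrite sqrtr_gt0 subr_gt0 (sabs2_lt kap0 kap1 rho2_gt). Qed.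

Lemma ilen2E x : ilen2 x = (L x ^+ 2)^-1.
Proof. by rewrite /ilen2 sqr_sqrtr// subr_ge0 ltW// (sabs2_lt kap0 kap1 rho2_gt). Qed.

Lemma len_lt x : L x < r.
Proof.
rewrite -[ltRHS](ger0_norm (ltW r0)) -sqrtr_sqr ltr_sqrt ?exprn_gt0//.
by apply: le_lt_trans rho2_r; rewrite gerBl sqr_ge0.
Qed.

Lemma targ_ge0 x y : (0 <= targ (x, y)) = (- L x <= y <= L x).
Proof.
have l0 := len_gt0 x.
rewrite /targ/= ilen2E -expr2 subr_ge0 ler_pdivrMr ?exprn_gt0// mul1r.
rewrite -ler_norml -(real_normK (num_real y)) ler_sqr ?nnegrE//.
exact: ltW.
Qed.

Lemma dxy_trial : dx trial = (fun p => dprofile eps (targ p) * - (p.2 * p.2 * dilen2 p.1)) /\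
  dy trial = (fun p => dprofile eps (targ p) * - (2 * p.2 * ilen2 p.1)).
Proof.
by have [_ _ -> ->] := partials_dxdy (trial_partials kap0 kap1 eps0 rho2_gt).
Qed.

Lemma trial_C1 : plane_C1 trial (dx trial) (dy trial).
Proof. exact/smooth_plane_C1/(trial_smooth kap0 kap1 eps0 rho2_gt). Qed.

Lemma dprofile_targ_le x y : dprofile eps (targ (x, y)) ^+ 2 <=
  if - L x <= y <= L x then (7 - 4 * (y ^+ 2 * ilen2 x)) ^+ 2 else 0.
Proof.
apply: le_trans (dprofile_bound eps0 _) _.
rewrite -targ_ge0; case: ifPn => [s0|s0].
  rewrite (ltW s0) le_eqVlt; apply/orP; left; apply/eqP; congr (_ ^+ 2).
  by rewrite /targ/=; ring.
by case: ifPn => // _; exact: sqr_ge0.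
Qed.

(* 6232 / 105 is the integral of c'(t)^2 over [-1, 1], 1288 / 45 that of
   t^2 c'(t)^2, and 1072 / 45 that of c(t)^2. *)
Lemma integral_dy_trial x :
  \int[lam]_(y in `[- r, r[) dy trial (x, y) ^+ 2 <= 6232 / 105 / L x.
Proof.
have [cv cvx cvy _ _] := trial_C1.
have l0 := len_gt0 x; have q0 := ilen2_gt0 kap0 kap1 rho2_gt x.
pose g := evenpoly 0 (196 * ilen2 x ^+ 2) (- 224 * ilen2 x ^+ 3) (64 * ilen2 x ^+ 4) 0.
apply: (@le_trans _ _ (\int[lam]_(y in `[- L x, L x]) g y)).
  have b y : dy trial (x, y) ^+ 2 <=
      4 * y ^+ 2 * ilen2 x ^+ 2 *
      (if - L x <= y <= L x then (7 - 4 * (y ^+ 2 * ilen2 x)) ^+ 2 else 0).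
    rewrite dxy_trial.2/= exprMn mulrC sqrrN !exprMn (_ : 2 ^+ 2 = 4 :> R); last by ring.
    apply: ler_wpM2l; last exact: dprofile_targ_le.
    exact: (mulr_ge0 (mulr_ge0 (ler0n _ 4) (sqr_ge0 _)) (sqr_ge0 _)).
  apply: Rintegral_le_core.
  - exact: len_lt.
  - by apply: continuous_sqr; exact: continuous_pair2.
  - exact: continuous_evenpoly.
  - move=> y yL; have := b y; rewrite (negbTE yL) mulr0 => h.
    by apply/eqP; rewrite eq_le h sqr_ge0.
  - move=> y yL; apply: le_trans (b y) _; rewrite yL le_eqVlt; apply/orP; left.
    by apply/eqP; rewrite /g /evenpoly; ring.
rewrite integral_evenpoly// ilen2E le_eqVlt; apply/orP; left; apply/eqP.
by field; rewrite gt_eqF.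
Qed.

(** With t = y / L and L L' = - sabs dsabs, the x-derivative without cut-off is, up to sign, t c'(t)
    sabs dsabs / L ^ 2; the change of variable gives back one factor L. *)
Lemma integral_dx_trial x : \int[lam]_(y in `[- r, r[) dx trial (x, y) ^+ 2 <=
  1288 / 45 * (sabs x * dsabs x) ^+ 2 / L x ^+ 3.
Proof.
have [cv cvx cvy _ _] := trial_C1.
have l0 := len_gt0 x; have q0 := ilen2_gt0 kap0 kap1 rho2_gt x.
pose d := dilen2 x ^+ 2.
pose g := evenpoly 0 0 (49 * d) (- 56 * ilen2 x * d) (16 * ilen2 x ^+ 2 * d).
apply: (@le_trans _ _ (\int[lam]_(y in `[- L x, L x]) g y)).
  have b y : dx trial (x, y) ^+ 2 <=
      y ^+ 4 * d * (if - L x <= y <= L x then (7 - 4 * (y ^+ 2 * ilen2 x)) ^+ 2 else 0).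
    rewrite dxy_trial.1/= exprMn mulrC sqrrN.
    have -> : (y * y * dilen2 x) ^+ 2 = y ^+ 4 * d by rewrite /d; ring.
    apply: ler_wpM2l; last exact: dprofile_targ_le.
    by rewrite mulr_ge0 ?sqr_ge0// (_ : y ^+ 4 = (y ^+ 2) ^+ 2) ?sqr_ge0// -exprM.
  apply: Rintegral_le_core.
  - exact: len_lt.
  - by apply: continuous_sqr; exact: continuous_pair2.
  - exact: continuous_evenpoly.
  - move=> y yL; have := b y; rewrite (negbTE yL) mulr0 => h.
    by apply/eqP; rewrite eq_le h sqr_ge0.
  - move=> y yL; apply: le_trans (b y) _; rewrite yL le_eqVlt; apply/orP; left.
    by apply/eqP; rewrite /g /evenpoly; ring.
rewrite integral_evenpoly// le_eqVlt; apply/orP; left; apply/eqP.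
rewrite /d /dilen2 ilen2E; field.
by rewrite gt_eqF.
Qed.

(** The loss 50 eps of [profile_sqr_ge] is incurred over an interval of length 2 L. *)
Lemma integral_trial x : (1072 / 45 - 100 * eps) * L x <=
  \int[lam]_(y in `[- r, r[) trial (x, y) ^+ 2.
Proof.
have [cv cvx cvy _ _] := trial_C1.
have l0 := len_gt0 x; have q0 := ilen2_gt0 kap0 kap1 rho2_gt x.
pose g := evenpoly (25 - 50 * eps) (- 70 * ilen2 x) (69 * ilen2 x ^+ 2) (- 28 * ilen2 x ^+ 3)
  (4 * ilen2 x ^+ 4).
apply: (@le_trans _ _ (\int[lam]_(y in `[- L x, L x]) g y)).
  rewrite integral_evenpoly// ilen2E le_eqVlt; apply/orP; left; apply/eqP.
  by field; rewrite gt_eqF.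
apply: Rintegral_ge_core.
- exact: len_lt.
- by apply: continuous_sqr; exact: continuous_pair2.
- exact: continuous_evenpoly.
- by move=> y; exact: sqr_ge0.
- move=> y yL; rewrite -targ_ge0 in yL.
  have s1 : 0 <= targ (x, y) <= 1.
    by rewrite yL/= /targ/= gerBl mulr_ge0 ?(ltW q0)// -expr2 sqr_ge0.
  apply: le_trans (profile_sqr_ge eps0 s1); rewrite le_eqVlt; apply/orP; left.
  by apply/eqP; rewrite /g /evenpoly /targ/=; ring.
Qed.

End trial_integrals.

(** * The explicit majorant of the energy density and its integral *)

Section majorant.
Context (R : realType) (rho1 K1 K4 e : R).
Hypotheses (rho10 : 0 < rho1) (rho1_gt : pi ^+ 2 + 4 <= rho1 ^+ 2).
Local Notation lam := (@lebesgue_measure R).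
Implicit Types x : R.

Definition m1 x := Num.sqrt (rho1 ^+ 2 - x ^+ 2).

Definition majorant x := K1 / m1 x + K4 * rho1 ^+ 2 / m1 x ^+ 3 + e.

(* tan (asin (x / rho1)) = x / m1 x, whose derivative is rho1^2 / m1^3. *)
Definition primitive x :=
  K1 * asin (x / rho1) + K4 * tan (asin (x / rho1)) + e * x.

Lemma m1_ge2 x : - pi <= x <= pi -> 2 <= m1 x.
Proof.
move=> /andP[x1 x2]; rewrite -[leLHS](@ger0_norm _ 2)// -sqrtr_sqr ler_wsqrtr//.
by have := rho1_gt; move: (pi : R) x1 x2 => p *; nra.
Qed.

Lemma div_rho1_itv x : - pi <= x <= pi -> -1 < x / rho1 < 1.
Proof.
move=> /andP[x1 x2]; have r0 := rho10; have := rho1_gt; have p0 := pi_gt0 R.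
move: (pi : R) p0 x1 x2 => p p0 x1 x2 h.
have pr : p < rho1 by nra.
by rewrite ltr_pdivlMr// ltr_pdivrMr//; apply/andP; split; lra.
Qed.

Lemma m1E x : m1 x = rho1 * Num.sqrt (1 - (x / rho1) ^+ 2).
Proof.
rewrite -{1}[rho1]ger0_norm ?ltW// -sqrtr_sqr -sqrtrM ?sqr_ge0//.
by congr Num.sqrt; field; rewrite gt_eqF.
Qed.

Lemma is_derive_primitive x : - pi <= x <= pi -> is_derive x 1 primitive (majorant x).
Proof.
move=> xpi; have xr := div_rho1_itv xpi; have m2 := m1_ge2 xpi.
have mE := m1E x; have r0 := rho10.
have s0 : 0 < Num.sqrt (1 - (x / rho1) ^+ 2).
  by rewrite -(pmulr_rgt0 _ r0) -mE; lra.
have hid := is_derive1Ml (rho1^-1) (is_derive_id x (1 : R)).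
have hid' : is_derive x 1 (fun t : R => t / rho1) (rho1^-1 * 1).
  by rewrite (_ : (fun t => _) = (fun t => rho1^-1 * t))//; apply/funext => t; rewrite mulrC.
have ha := @is_derive1_comp R asin (fun t => t / rho1) x _ _ (is_derive1_asin xr) hid'.
have hc : cos (asin (x / rho1)) != 0.
  by rewrite cos_asin ?gt_eqF//; case/andP: xr => /ltW -> /ltW ->.
have ht := @is_derive1_comp R tan (fun t => asin (t / rho1)) x _ _
  (is_derive_tan hc) ha.
have he := is_derive1Ml e (is_derive_id x (1 : R)).
have h : is_derive x 1 primitive _ :=
  is_deriveD (is_deriveD (is_derive1Ml K1 ha) (is_derive1Ml K4 ht)) he.
apply: is_derive_eq h _; rewrite /majorant mE cos_asin; last first.
  by case/andP: xr => /ltW -> /ltW ->.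
by field; rewrite !gt_eqF.
Qed.

Lemma continuous_majorant : {within `[- pi, pi], continuous majorant}.
Proof.
apply: continuous_in_subspaceT => x; rewrite inE/= in_itv/= => xpi.
have m2 := m1_ge2 xpi.
have cm : {for x, continuous m1}.
  apply: (@continuous_comp _ _ _ (fun x => rho1 ^+ 2 - x ^+ 2) Num.sqrt).
    by apply: cvgB; [exact: cvg_cst|exact: exprn_continuous].
  exact: sqrt_continuous.
have n0 : m1 x != 0 by rewrite gt_eqF//; lra.
apply: cvgD; last exact: cvg_cst.
apply: cvgD.
  by apply: cvgM; [exact: cvg_cst|apply: cvgV].
apply: cvgM; first exact: cvg_cst.
apply: cvgV; first by rewrite expf_neq0.
by apply: (@continuous_comp _ _ _ m1 (fun t => t ^+ 3)) => //; exact: exprn_continuous.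
Qed.

Lemma asinN x : -1 <= x <= 1 -> asin (- x) = - asin x.
Proof.
move=> x1; have h1 := asin_lepi2 x1; have h2 := asin_geNpi2 x1.
rewrite -{1}(asinK (_ : x \in `[-1, 1])) ?in_itv//= -sinN sinK//.
by rewrite in_itv/=; apply/andP; split; lra.
Qed.

Lemma integral_majorant :
  lam.-integrable (`[- pi, pi]%classic : set (measurableTypeR R)) (EFin \o majorant) /\
  \int[lam]_(x in `[- pi, pi]) majorant x =
  2 * (K1 * asin (pi / rho1) + K4 * (pi / m1 pi) + e * pi).
Proof.
have p0 := pi_gt0 R; have pp : - pi < pi :> R by lra.
split.
  by apply: continuous_compact_integrable; [exact: segment_compact|exact: continuous_majorant].
have dp x : - pi <= x <= pi -> {for x, continuous primitive}.
  move=> /is_derive_primitive h; apply: differentiable_continuous.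
  by apply/derivable1_diffP; case: h.
have ppi : - (@pi R) <= @pi R <= @pi R by apply/andP; split; lra.
have npi : - (@pi R) <= - (@pi R) <= @pi R by apply/andP; split; lra.
rewrite /Rintegral (@continuous_FTC2 _ _ primitive)//.
- have xr := div_rho1_itv ppi.
  have xr' : -1 <= pi / rho1 <= 1 by case/andP: xr => /ltW -> /ltW ->.
  rewrite /= /primitive mulNr asinN// tanN /tan asinK ?in_itv//= cos_asin//.
  have m2 := m1_ge2 ppi; rewrite m1E in m2 *.
  have s0 : Num.sqrt (1 - (pi / rho1) ^+ 2) != 0.
    by apply/eqP => s0; move: m2; rewrite s0 mulr0; lra.
  by field; rewrite s0 gt_eqF.
- exact: continuous_majorant.
- split.
  + move=> x; rewrite in_itv/= => /andP[x1 x2].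
    by have [] : is_derive x 1 primitive (majorant x)
      by apply: is_derive_primitive; rewrite !ltW.
  + exact/cvg_at_right_filter/dp.
  + exact/cvg_at_left_filter/dp.
- move=> x; rewrite in_itv/= => /andP[x1 x2].
  have h : is_derive x 1 primitive (majorant x) by apply: is_derive_primitive; rewrite !ltW.
  by rewrite derive1E; exact: derive_val.
Qed.

End majorant.

(** Meant for S half of the area, a S a lower bound of the squared norm and 2 K an upper bound of
    the energy: S cancels and K < p a remains. *)
Lemma quotient_lt (R : realFieldType) (p a K S D N : R) : 0 < p -> 0 < a -> 0 < S ->
  a * S <= D -> N <= 2 * K -> K < p * a -> N / D < 4 * p / (2 * S).
Proof.
move=> p0 a0 S0 aSD NK Kpa; have D0 : 0 < D by apply: lt_le_trans aSD; exact: mulr_gt0.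
rewrite ltr_pdivrMr// mulrAC ltr_pdivlMr; last by rewrite mulr_gt0.
have h1 : N * (2 * S) <= 2 * K * (2 * S) by rewrite ler_pM2r// mulr_gt0.
have h2 : 2 * K * (2 * S) < 4 * p * (a * S).
  rewrite [ltRHS](_ : _ = 2 * (p * a) * (2 * S)); last by ring.
  by rewrite ltr_pM2r ?mulr_gt0// ltr_pM2l.
apply: le_lt_trans h1 (lt_le_trans h2 _).
by rewrite ler_pM2l// mulr_gt0.
Qed.

(** * The Rayleigh quotient of the trial function compared with the area *)

Section rayleigh_quotient.
Context (R : realType) (r kap eps rho2 rho1 : R).
Hypotheses (r0 : 0 < r) (kap0 : 0 < kap) (kap1 : kap <= 1 / 10) (eps0 : 0 < eps).
Hypotheses (rho10 : 0 < rho1) (rho2E : rho2 = r ^+ 2 - 7 * kap).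
Hypotheses (rho1_gt : pi ^+ 2 + 4 <= rho1 ^+ 2).
Hypotheses (rho1_r : rho1 ^+ 2 <= r ^+ 2 - 14 * kap).
Hypothesis pi_lt : pi <= 22 / 7 :> R.
Local Notation lam := (@lebesgue_measure R).
Local Notation Om := (geodesic_disk ((0 : R), (0 : R)) r).
Local Notation trial := (trial kap eps rho2).
Local Notation sabs := (sabs kap).
Local Notation dsabs := (dsabs kap).
Local Notation L := (len kap rho2).
Local Notation I := (`[- pi, pi]%classic : set (measurableTypeR R)).
Local Notation J := (`[- r, r[%classic : set (measurableTypeR R)).

Let kapW : kap <= 1 / 2. Proof. by apply: le_trans kap1 _; lra. Qed.
Let kap_lt1 : kap < 1. Proof. by apply: le_lt_trans kap1 _; lra. Qed.
Let rho2_gt : pi ^+ 2 < rho2.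
Proof.
have := rho1_gt; have := rho1_r; have := kap0; have := rho2E.
by move: (pi : R) => p *; lra.
Qed.
Let rho2_r : rho2 < r ^+ 2. Proof. by have := rho2E; have := kap0; lra. Qed.

Let mOm := measurable_cell_disk r0.
Let OmH := cell_disk_height r0.
Let test_trial : test_function Om trial.
Proof. exact: (trial_test r0 kap0 kapW eps0 rho2E rho2_gt pi_lt). Qed.

(** Since pi <= 22 / 7 and kap <= 1 / 10, the increase 2 pi kap + kap ^ 2 is at most 7 kap. *)
Lemma sabs_sqr_le x : - pi <= x <= pi -> sabs x ^+ 2 <= x ^+ 2 + 7 * kap.
Proof.
move=> xpi; have /andP[_ s1] := sabs_near kap0 kap_lt1 xpi.
have s0 := sabs_gt0 kap0 kap_lt1 x.
have xp : `|x| <= pi by rewrite ler_norml.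
have := kap0; have := kap1; have := pi_lt; move: (pi : R) xp => p.
rewrite -(real_normK (num_real x)); have := normr_ge0 x.
by move: `|x| (sabs x) s1 s0 => z s; nra.
Qed.

(** Half of the margin 14 kap is r ^ 2 - rho2, the other half is the error made on x ^ 2 by
    [sabs]. *)
Lemma len_ge_m1 x : - pi <= x <= pi -> m1 rho1 x <= L x.
Proof.
move=> xpi; apply: ler_wsqrtr; have := sabs_sqr_le xpi.
by have := rho1_r; have := rho2E; lra.
Qed.

Lemma dsabs_sabs_le x : (sabs x * dsabs x) ^+ 2 <= sabs x ^+ 2.
Proof.
rewrite exprMn ger_pMr; first exact: (dsabs_sqr_le1 kap0 kap_lt1).
by rewrite exprn_gt0//; exact: (sabs_gt0 kap0 kap_lt1).
Qed.

Let c1 : R := 6232 / 105.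
Let K4 : R := 1288 / 45.
(** The error 7 kap on x ^ 2, divided by the cube of [m1], which is at least 8. *)
Let e := K4 * (7 * kap / 8).
Let B := majorant rho1 (c1 - K4) K4 e.

(** Once [L] is replaced by its lower bound [m1], the identity x ^ 2 = rho1 ^ 2 - m1 ^ 2 splits the
    second term; this is why 1 / m1 carries the coefficient c1 - K4. *)
Lemma energy_density_le x : - pi <= x <= pi ->
  c1 / L x + K4 * (sabs x * dsabs x) ^+ 2 / L x ^+ 3 <= B x.
Proof.
move=> xpi; have m2 := m1_ge2 rho1_gt xpi; have mL := len_ge_m1 xpi.
have mE : m1 rho1 x ^+ 2 = rho1 ^+ 2 - x ^+ 2.
  rewrite sqr_sqrtr// subr_ge0; have := rho1_gt; move/andP: xpi => [].
  by move: (pi : R) => p *; nra.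
have s1 := sabs_sqr_le xpi; have s2 := dsabs_sabs_le x.
have K40 : 0 <= K4 by rewrite /K4; lra.
have c10 : 0 <= c1 by rewrite /c1; lra.
have k0 := kap0.
rewrite /B /majorant /e.
move: (m1 rho1 x) (L x) m2 mL mE s2 => m l m2 ml mE s2.
have m0 : 0 < m by lra.
have l0 : 0 < l by lra.
have m00 := ltW m0; have l00 := ltW l0.
have i1 : l^-1 <= m^-1 by rewrite lef_pV2.
have i3 : (l ^+ 3)^-1 <= (m ^+ 3)^-1.
  by rewrite lef_pV2 ?posrE ?exprn_gt0// lerXn2r ?nnegrE.
have i8 : (m ^+ 3)^-1 <= 8^-1.
  rewrite lef_pV2 ?posrE ?exprn_gt0//.
  by apply: (@le_trans _ _ (2 ^+ 3)); [lra|rewrite lerXn2r ?nnegrE].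
have i30 : 0 <= (m ^+ 3)^-1 by rewrite invr_ge0 exprn_ge0// ltW.
apply: (@le_trans _ _ (c1 / m + K4 * (x ^+ 2 + 7 * kap) / m ^+ 3)).
  apply: lerD; first by rewrite ler_wpM2l.
  apply: ler_pM => //; first by rewrite mulr_ge0// sqr_ge0.
    by rewrite invr_ge0 exprn_ge0// ltW.
  by rewrite ler_wpM2l// (le_trans s2).
have -> : rho1 ^+ 2 = m ^+ 2 + x ^+ 2 by rewrite mE; ring.
have -> : (c1 - K4) / m + K4 * (m ^+ 2 + x ^+ 2) / m ^+ 3 =
  c1 / m + K4 * x ^+ 2 / m ^+ 3 by field; rewrite gt_eqF.
rewrite mulrDr mulrDl addrA lerD2l.
have -> : K4 * (7 * kap / 8) = K4 * (7 * kap) * 8^-1 by ring.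
by apply: ler_wpM2l i8; rewrite mulr_ge0//; lra.
Qed.

Lemma box_fubini (f : R * R -> R) : continuous f ->
  lam.-integrable I (EFin \o (fun x => \int[lam]_(y in J) f (x, y))) /\
  \int[leb2 R]_(p in I `*` J) f p = \int[lam]_(x in I) \int[lam]_(y in J) f (x, y).
Proof.
move=> cf; have rp := r0; have p0 := pi_gt0 R.
apply: (@fubini_plane R (pi + r)) => //; try exact: measurable_itv.
- by move=> x /=; rewrite !in_itv/= => /andP[x1 x2]; apply/andP; split; lra.
- by move=> x /=; rewrite !in_itv/= => /andP[x1 x2]; apply/andP; split; lra.
Qed.

Lemma cdot_box (f : R * R -> R) : continuous f -> (forall p, ~ Om p -> f p = 0) ->
  cdot Om f f = \int[lam]_(x in I) \int[lam]_(y in J) f (x, y) ^+ 2.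
Proof.
move=> cf f0; rewrite cdot_sqrE (integral_cell_box OmH).
  exact: (box_fubini (continuous_sqr cf)).2.
by move=> p /f0 ->; rewrite expr0n.
Qed.

Lemma energy_le (f g : R * R -> R) (b : R -> R) : continuous f -> continuous g ->
  (forall p, ~ Om p -> f p = 0) -> (forall p, ~ Om p -> g p = 0) ->
  lam.-integrable I (EFin \o b) ->
  (forall x, - pi <= x <= pi -> \int[lam]_(y in J) f (x, y) ^+ 2 +
     \int[lam]_(y in J) g (x, y) ^+ 2 <= b x) ->
  cdot Om f f + cdot Om g g <= \int[lam]_(x in I) b x.
Proof.
move=> cf cg f0 g0 ib fgb; rewrite (cdot_box cf f0) (cdot_box cg g0).
have mI : measurable I by exact: measurable_itv.
have [iX _] := box_fubini (continuous_sqr cf).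
have [iY _] := box_fubini (continuous_sqr cg).
rewrite -(RintegralD mI iX iY); apply: (le_Rintegral mI) => //.
  exact: (integrableD mI iX iY).
Qed.

Lemma grad_trial_le : grad Om trial trial <=
  2 * ((c1 - K4) * asin (pi / rho1) + K4 * (pi / m1 rho1 pi) + e * pi).
Proof.
have [cv cvx cvy _ _] := trial_C1 kap0 kap_lt1 eps0 rho2_gt.
have out p := test_function_out test_trial p.
have [iB <-] := integral_majorant (c1 - K4) K4 e rho10 rho1_gt.
apply: (energy_le cvx cvy (fun p Np => let: And3 _ e _ := out p Np in e)
  (fun p Np => let: And3 _ _ e := out p Np in e) iB) => x xpi.
have hx := integral_dx_trial r0 kap0 kap_lt1 eps0 rho2_r rho2_gt x.
have hy := integral_dy_trial r0 kap0 kap_lt1 eps0 rho2_r rho2_gt x.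
apply: le_trans (lerD hx hy) _.
by rewrite addrC; exact: energy_density_le.
Qed.

Let l x := Num.sqrt (r ^+ 2 - x ^+ 2).

Lemma l_ge2 x : - pi <= x <= pi -> 2 <= l x.
Proof.
move=> /andP[x1 x2]; rewrite -[leLHS](@ger0_norm _ 2)// -sqrtr_sqr ler_wsqrtr//.
have := rho1_gt; have := rho1_r; have := kap0.
by move: (pi : R) x1 x2 => p *; nra.
Qed.

(** The squares differ by at most 14 kap, and l ^ 2 >= 4 turns this into a relative error 14 kap / 4
    <= 8 kap - 16 kap ^ 2. The relative form keeps the exact area as a factor, ready to cancel. *)
Lemma len_ge_l x : - pi <= x <= pi -> (1 - 4 * kap) * l x <= L x.
Proof.
move=> xpi; have l2 := l_ge2 xpi; have s1 := sabs_sqr_le xpi.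
have lE : l x ^+ 2 = r ^+ 2 - x ^+ 2.
  by rewrite sqr_sqrtr// leNgt; apply/negP => /ltW h; move: l2; rewrite /l ler0_sqrtr//; lra.
have L0 := len_gt0 kap0 kap_lt1 rho2_gt x.
have LE : L x ^+ 2 = rho2 - sabs x ^+ 2.
  by rewrite sqr_sqrtr// subr_ge0 ltW// (sabs2_lt kap0 kap_lt1 rho2_gt).
have k0 := kap0; have k1 := kap1; have rE := rho2E.
rewrite -ler_sqr ?nnegrE ?(ltW L0)//; last by rewrite mulr_ge0//; lra.
rewrite LE exprMn; move: (l x) l2 lE => z l2 lE.
have h : (1 - 4 * kap) ^+ 2 <= 1 - 14 * kap / 4 by nra.
apply: le_trans (ler_wpM2r (sqr_ge0 z) h) _.
have z4 : 4 <= z ^+ 2 by nra.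
have := ler_wpM2l (ltW k0) z4; move: s1; rewrite rE.
rewrite mulrBl mul1r lE => s1.
by move: (sabs x ^+ 2) s1 => s s1; lra.
Qed.

Definition half_area := \int[lam]_(x in I) l x.

Lemma continuous_l : continuous l.
Proof.
move=> x.
apply: (@continuous_comp R R R (fun x : R => r ^+ 2 - x ^+ 2) (@Num.sqrt R) x).
  by apply: cvgB; [exact: cvg_cst|exact: exprn_continuous].
exact: sqrt_continuous.
Qed.

Lemma half_area_gt0 : 0 < half_area.
Proof.
have p0 := pi_gt0 R; have pp : - pi < pi :> R by lra.
apply: (@lt_le_trans _ _ (\int[lam]_(x in I) 2)).
  have lI : lam I = (pi - - pi)%:E by rewrite lebesgue_measure_itv/= lte_fin pp.
  rewrite Rintegral_cst; last exact: measurable_itv.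
  by move: lI => /= ->; rewrite mulr_gt0//= subr_gt0.
apply: le_Rintegral; first exact: measurable_itv.
- by apply: continuous_itv_integrable => x; exact: cvg_cst.
- exact: continuous_itv_integrable continuous_l.
- by move=> x; rewrite /= in_itv/= => /l_ge2.
Qed.

(** The vertical section over each x of [-pi, pi] is the interval ]- l x, l x[, nonempty because l x
    >= 2. *)
Lemma area_diskE : area Om = 2 * half_area.
Proof.
rewrite /half_area -RintegralZl; last 2 first.
- exact: measurable_itv.
- exact: continuous_itv_integrable continuous_l.
rewrite /area /leb2 /product_measure1 /Rintegral; congr fine.
rewrite [RHS]integral_mkcond; apply: eq_integral => x _ /=.
rewrite patchE; case: ifPn => [xI|xI]; last first.
  rewrite (_ : xsection _ x = set0) ?measure0//.
  apply/seteqP; split => // y /xsectionP; rewrite cell_diskE// => -[sx _].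
  by move/negP : xI; apply; rewrite inE/= in_itv.
have xpi : - pi <= x <= pi by move: xI; rewrite inE/= in_itv.
have l2 := l_ge2 xpi.
have lE : l x ^+ 2 = r ^+ 2 - x ^+ 2.
  by rewrite sqr_sqrtr// leNgt; apply/negP => /ltW h; move: l2; rewrite /l ler0_sqrtr//; lra.
rewrite (_ : xsection _ x = `]- l x, l x[%classic).
  rewrite lebesgue_measure_itv/= lte_fin ifT; last by lra.
  by rewrite -EFinB; congr EFin; ring.
apply/seteqP; split => y.
  move=> /xsectionP; rewrite cell_diskE// => -[_ /= h].
  by rewrite in_itv/=; apply/andP; split; nra.
rewrite /= in_itv/= => /andP[h1 h2]; apply/xsectionP; rewrite cell_diskE//.
by split => //=; nra.
Qed.

Lemma cdot_trial_ge : 100 * eps <= 1 ->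
  (1072 / 45 - 100 * eps) * ((1 - 4 * kap) * half_area) <= cdot Om trial trial.
Proof.
move=> e1; have d0 : 0 <= 1072 / 45 - 100 * eps by lra.
have [cv _ _ _ _] := trial_C1 kap0 kap_lt1 eps0 rho2_gt.
have out p := test_function_out test_trial p.
rewrite (cdot_box cv); last by move=> p /(out p)[].
have [iV _] := box_fubini (continuous_sqr cv).
have il := continuous_itv_integrable (- pi) pi continuous_l.
have mI : measurable I by exact: measurable_itv.
rewrite /half_area mulrA -(RintegralZl _ mI il).
apply: (le_Rintegral mI (integrableZl mI _ il) iV).
move=> x; rewrite /= in_itv/= => xpi.
apply: le_trans (integral_trial r0 kap0 kap_lt1 eps0 rho2_r rho2_gt x).
by rewrite -mulrA; exact: (ler_wpM2l d0 (len_ge_l xpi)).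
Qed.

Lemma not_polya_of_bound : 100 * eps <= 1 ->
  (c1 - K4) * asin (pi / rho1) + K4 * (pi / m1 rho1 pi) + e * pi <
    pi * ((1072 / 45 - 100 * eps) * (1 - 4 * kap)) ->
  ~ satisfies_polya Om.
Proof.
move=> e1.
have a0 : 0 < (1072 / 45 - 100 * eps) * (1 - 4 * kap).
  by have k1 := kap1; apply: mulr_gt0; lra.
move=> hK /(_ 1%N isT) polya.
have D := cdot_trial_ge e1; rewrite mulrA in D.
have D0 := lt_le_trans (mulr_gt0 a0 half_area_gt0) D.
have := le_trans polya (eigenvalue1_le mOm r0 OmH test_trial D0).
rewrite lee_fin area_diskE mulr1.
apply/negP; rewrite -ltNge.
exact: (quotient_lt (pi_gt0 R) a0 half_area_gt0 D grad_trial_le hK).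
Qed.

End rayleigh_quotient.

(** * Rational bounds for pi and the arc sine, and the numerical conclusion *)

Section trigonometric_bounds.
Context (R : realType).
Implicit Types (x : R) (k : nat).

Definition cos_poly k x : R := \sum_(i < k) (-1) ^+ i / (2 * i)`!%:R * x ^+ (2 * i).
Definition sin_poly k x : R :=
  \sum_(i < k) (-1) ^+ i / (2 * i).+1`!%:R * x ^+ (2 * i).+1.

Lemma is_derive_sin_poly k x : is_derive x 1 (sin_poly k) (cos_poly k x).
Proof.
elim: k => [|k IH].
  rewrite /cos_poly big_ord0 (_ : sin_poly 0 = cst 0); first exact: is_derive_cst.
  by apply/funext => t; rewrite /sin_poly big_ord0.
rewrite /cos_poly big_ord_recr/= (_ : sin_poly k.+1 = fun t => sin_poly k t +
    (-1) ^+ k / (2 * k)`!%:R / (2 * k).+1%:R * t ^+ (2 * k).+1).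
  exact: is_deriveD IH (is_derive_monomial _ _ _).
apply/funext => t; rewrite /sin_poly big_ord_recr/=; congr (_ + _ * _).
by rewrite factS natrM invfM mulrA mulrAC.
Qed.

Lemma is_derive_cos_poly k x : is_derive x 1 (cos_poly k.+1) (- sin_poly k x).
Proof.
elim: k => [|k IH].
  rewrite /sin_poly big_ord0 oppr0 (_ : cos_poly 1 = cst 1); first exact: is_derive_cst.
  by apply/funext => t; rewrite /cos_poly big_ord1 muln0 fact0 !expr0 divr1 mulr1.
have := is_deriveD IH (is_derive_monomial ((-1) ^+ k.+1 / (2 * k).+1`!%:R) (2 * k).+1 x).
rewrite (_ : - sin_poly k.+1 x = - sin_poly k x + (-1) ^+ k.+1 / (2 * k).+1`!%:R * x ^+ (2 * k).+1).
  rewrite (_ : cos_poly k.+2 = cos_poly k.+1 +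
    (fun t => (-1) ^+ k.+1 / (2 * k).+1`!%:R / (2 * k).+2%:R * t ^+ (2 * k).+2)) //.
  apply/funext => t; rewrite /cos_poly big_ord_recr/=; congr (_ + _).
  by rewrite mulnS add2n; congr (_ * _); rewrite factS natrM invfM mulrA mulrAC.
by rewrite /sin_poly big_ord_recr/= opprD [(-1) ^+ k.+1]exprS mulN1r !mulNr.
Qed.

Lemma ge0_of_derive (f df : R -> R) : (forall x, is_derive x 1 f (df x)) ->
  f 0 = 0 -> (forall x, 0 <= x -> 0 <= df x) -> forall x, 0 <= x -> 0 <= f x.
Proof.
move=> f' f0 df0 x x0.
have [c] := MVT_segment x0 (fun t _ => f' t)
  (continuous_subspaceT (is_derive_continuous f')).
rewrite in_itv/= f0 !subr0 => /andP[c0 _] ->.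
by rewrite mulr_ge0// df0.
Qed.

Lemma sin_poly0 k : sin_poly k 0 = 0.
Proof.
by rewrite /sin_poly big1// => i _; rewrite expr0n mulr0.
Qed.

Lemma cos_poly0 k : cos_poly k.+1 0 = 1.
Proof.
rewrite /cos_poly big_ord_recl/= muln0 fact0 !expr0 divr1 mulr1 big1 ?addr0// => i _.
by rewrite expr0n mulr0.
Qed.

(* Each Taylor polynomial bounds from one side, by integrating the previous
   bound; the sides alternate. *)
Lemma taylor_bounds k x : 0 <= x ->
  0 <= (-1) ^+ k.+1 * (cos x - cos_poly k.+1 x) /\
  0 <= (-1) ^+ k.+1 * (sin x - sin_poly k.+1 x).
Proof.
have sin_step j : (forall x, 0 <= x -> 0 <= (-1) ^+ j * (cos x - cos_poly j x)) ->
    forall x, 0 <= x -> 0 <= (-1) ^+ j * (sin x - sin_poly j x).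
  move=> h; apply: ge0_of_derive h => [z|].
    by apply: is_derive1Ml; apply: is_deriveB; exact: is_derive_sin_poly.
  by rewrite sin0 sin_poly0 subrr mulr0.
suff H : forall x, 0 <= x -> 0 <= (-1) ^+ k.+1 * (cos x - cos_poly k.+1 x).
  by move=> x0; split; [exact: H|exact: sin_step H _ x0].
elim: k {x} => [|k IH] x x0.
  rewrite expr1 mulN1r opprB subr_ge0.
  by rewrite /cos_poly big_ord1 muln0 fact0 !expr0 divr1 mulr1 cos_le1.
have hs := sin_step _ IH.
apply: (@ge0_of_derive (fun x => (-1) ^+ k.+2 * (cos x - cos_poly k.+2 x))
  (fun x => (-1) ^+ k.+1 * (sin x - sin_poly k.+1 x)) _ _ hs x x0) => [z|].
  have h : is_derive z 1 (fun t => cos t - cos_poly k.+2 t) (- sin z - - sin_poly k.+1 z).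
    by apply: is_deriveB; exact: is_derive_cos_poly.
  by apply: is_derive_eq (is_derive1Ml _ h) _; rewrite exprS; ring.
by rewrite cos0 cos_poly0 subrr mulr0.
Qed.

Lemma natr_fact : (2`!%:R = 2 :> R) * (3`!%:R = 6 :> R) * (4`!%:R = 24 :> R) *
  (5`!%:R = 120 :> R) * (6`!%:R = 720 :> R) * (8`!%:R = 56 * 720 :> R).
Proof. by rewrite -natrM !factS fact0. Qed.

Lemma mul2n_small : (2 * 0 = 0)%N * (2 * 1 = 2)%N * (2 * 2 = 4)%N * (2 * 3 = 6)%N *
  (2 * 4 = 8)%N.
Proof. by []. Qed.

(** Were pi <= 3.13, the cosine of 1.565 would be at most 0, against its Taylor lower bound of
    degree 6. *)
Lemma pi_gt_313 : 313 / 100 < pi :> R.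
Proof.
have p2 := pi_ge2 R; rewrite ltNge; apply/negP => h.
have x0 : 0 <= 1565 / 1000 :> R by lra.
have [c _] := taylor_bounds 3 x0.
have : cos (1565 / 1000) <= 0 :> R.
  rewrite -(cos_pihalf R) leNgt; apply/negP => h1.
  move: h1; rewrite ltr_cos ?in_itv/=; [lra| |]; by apply/andP; split; lra.
move: c; rewrite /cos_poly !big_ord_recr big_ord0 /= !mul2n_small !natr_fact fact0.
lra.
Qed.

(** Were pi > 22 / 7, the cosine of 11 / 7 would be positive, against its Taylor upper bound of
    degree 8. *)
Lemma pi_le_22_7 : pi <= 22 / 7 :> R.
Proof.
have p2 := pi_ge2 R; rewrite leNgt; apply/negP => h.
have x0 : 0 <= 11 / 7 :> R by lra.
have [c _] := taylor_bounds 4 x0.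
have : 0 < cos (11 / 7) :> R by apply: cos_gt0_pihalf; apply/andP; split; lra.
move: c; rewrite /cos_poly !big_ord_recr big_ord0 /= !mul2n_small !natr_fact fact0.
lra.
Qed.

(** The value 0.836 is just above (22 / 7) / 3.7606, the bound on the argument of the arc sine in
    the final estimate. *)
Lemma sin_99_ge : 836 / 1000 <= sin (99 / 100) :> R.
Proof.
have x0 : 0 <= 99 / 100 :> R by lra.
have [_ c] := taylor_bounds 3 x0.
move: c; rewrite /sin_poly !big_ord_recr big_ord0 /= !mul2n_small.
rewrite [7`!]factS natrM !natr_fact factS fact0.
lra.
Qed.

Lemma asin_le_99 (u : R) : 0 <= u <= 836 / 1000 -> asin u <= 99 / 100.
Proof.
move=> /andP[u0 u1]; have p := pi_gt_313.
have ui : -1 <= u <= 1 by apply/andP; split; lra.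
rewrite leNgt -ltr_sin ?in_itv/=; last 2 first.
- by apply/andP; split; lra.
- by rewrite asin_geNpi2// asin_lepi2.
rewrite asinK ?in_itv//= -leNgt; apply: le_trans u1 sin_99_ge.
Qed.

(** The tangent line of the square function at 3.76085 bounds r ^ 2 below by a linear function of
    r. *)
Lemma radius_margin (r : R) : 376 / 10 ^+ 2 + 85 / 10 ^+ 5 < r ->
  (376 / 100 + 6 / 100 ^+ 2) ^+ 2 <= r ^+ 2 - 14 * (1 / 100 ^+ 2).
Proof.
move=> hr; have := sqr_ge0 (r - (376 / 100 + 85 / (100 * 1000))).
rewrite sqrrB; lra.
Qed.

End trigonometric_bounds.

Theorem theorem4p1 (R : realType) :
  exists R1 : R,
    R1 = 376 / 10 ^+ 2 + 85 / 10 ^+ 5 /\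
    forall r : R, R1 < r -> ~ satisfies_polya (geodesic_disk (0, 0) r).
Proof.
eexists; split; first reflexivity.
move=> r hr.
(* [rho1] = 3.7606 is 0.00025 below the threshold; the squares then differ by more than 0.0018,
   enough for the margin 14 kap = 0.0014. *)
pose kap : R := 1 / 100 ^+ 2; pose rho1 : R := 376 / 100 + 6 / 100 ^+ 2.
pose R1 : R := 376 / 10 ^+ 2 + 85 / 10 ^+ 5.
have R1E : R1 = 376 / 100 + 85 / (100 * 1000) by rewrite /R1; lra.
have pl := pi_le_22_7 R; have pg := pi_gt_313 R.
have r0 : 0 < r by lra.
have kap0 : 0 < kap by rewrite /kap; lra.
have rho0 : 0 < rho1 by rewrite /rho1; lra.
have p2 : pi ^+ 2 <= (22 / 7) ^+ 2 :> R by rewrite lerXn2r ?nnegrE//; lra.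
have rho1_gt : pi ^+ 2 + 4 <= rho1 ^+ 2 by rewrite /rho1; lra.
have rho1_r : rho1 ^+ 2 <= r ^+ 2 - 14 * kap by exact: radius_margin hr.
have kap1 : kap <= 1 / 10 by rewrite /kap; lra.
(* The same small number serves for the smoothing and for the cut-off eps. *)
apply: (@not_polya_of_bound R r kap kap (r ^+ 2 - 7 * kap) rho1) => //.
  by rewrite /kap; lra.
have ha : asin (pi / rho1) <= 99 / 100.
  apply: asin_le_99; rewrite divr_ge0 ?(ltW rho0) ?pi_ge0//=.
  by rewrite ler_pdivrMr// /rho1; lra.
have hm : 206 / 100 <= m1 rho1 pi.
  rewrite -[leLHS]ger0_norm; last by lra.
  by rewrite -sqrtr_sqr ler_wsqrtr// /rho1; lra.
have hq : pi / m1 rho1 pi <= (22 / 7) / (206 / 100).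
  have m0 : 0 < m1 rho1 pi by apply: lt_le_trans hm; lra.
  apply: ler_pM; [exact: pi_ge0|by rewrite invr_ge0 ltW|exact: pl|].
  by rewrite lef_pV2 ?posrE//; lra.
move: (asin _) (pi / m1 _ _) ha hq => A q ha hq.
(* With these bounds and pi > 3.13 the two sides are about 74.10 and 74.50. *)
rewrite /kap; lra.
Qed.
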